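(* For all integers $s,t\ge2$, $$F(s;(t+1))=F(t;(s+1))$$ in $\mathbb{R}[[X]]$, where for an admissible index $\boldsymbol{k}$ and an integer $s\ge2$, $$F(s;\boldsymbol{k}):=\mathcal{O}((s)\,\widetilde{ш}\,\boldsymbol{k})-\mathcal{O}((s)\,\widetilde{ш}\,\boldsymbol{k}^\dagger).$$
   Context: An index is a finite sequence $\boldsymbol{k}=(k_1,\dots,k_r)$ of positive integers; $r$ is its depth. It is admissible if it is non-empty and its last component is greater than $1$. $\{a\}^n$ denotes $a$ repeated $n$ times. For $\boldsymbol{e}\in\mathbb{Z}_{\ge0}^r$, $|\boldsymbol{e}|$ is the sum of the components, and $\oplus$ denotes componentwise addition. Multiple zeta values: for an admissible index, $\zeta(k_1,\dots,k_r)=\sum_{1\le m_1<\cdots<m_r}\frac{1}{m_1^{k_1}\cdots m_r^{k_r}}\in\mathbb{R}$. Dual index: every admissible index can be written uniquely as $\boldsymbol{k}=(\{1\}^{a_1-1},b_1+1,\dots,\{1\}^{a_l-1},b_l+1)$ with $l\ge1$ and all $a_p,b_q\ge1$; then $\boldsymbol{k}^\dagger:=(\{1\}^{b_l-1},a_l+1,\dots,\{1\}^{b_1-1},a_1+1)$. In particular $(t+1)^\dagger=(\{1\}^{t-1},2)$. Ohno sums: for an admissible index $\boldsymbol{k}$ of depth $r$ and $m\ge0$, $\mathcal{O}_m(\boldsymbol{k}):=\sum_{\boldsymbol{e}\in\mathbb{Z}_{\ge0}^r,\,|\boldsymbol{e}|=m}\zeta(\boldsymbol{k}\oplus\boldsymbol{e})$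 and $\mathcal{O}(\boldsymbol{k}):=\sum_{m=0}^\infty\mathcal{O}_m(\boldsymbol{k})X^m\in\mathbb{R}[[X]]$; $\mathcal{O}$ is extended linearly to formal sums of admissible indices. $\boldsymbol{k}\,\widetilde{ш}\,\boldsymbol{l}$ denotes the formal sum (with multiplicity) of all shuffles of the sequences $\boldsymbol{k}$ and $\boldsymbol{l}$, e.g. $(a)\,\widetilde{ш}\,(b,c)=(a,b,c)+(b,a,c)+(b,c,a)$. *)

(* Defs.v *)
From mathcomp Require Import all_boot all_order all_algebra.
From mathcomp Require Import all_classical all_reals all_analysis.

Set Implicit Arguments.
Unset Strict Implicit.
Unset Printing Implicit Defensive.

Import Order.TTheory GRing.Theory Num.Theory.

Local Open Scope classical_set_scope.
Local Open Scope ring_scope.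

(* Indices are represented by [seq nat]; [admissible] also includes the
   positivity of the components.  The functions below are total, and their
   values on other sequences carry no meaning. *)
Definition admissible (k : seq nat) : bool :=
  [&& k != [::], all (fun x => 0 < x)%N k & (1 < last 0 k)%N].

(* [path ltn 0 m] says 1 <= m_1 < ... < m_r.  All terms are nonnegative, so
   the multiple series is the supremum of its finite partial sums; it is finite
   for admissible [k], and [fine] maps a divergent series to 0. *)
Definition zeta (R : realType) (k : seq nat) : R :=
  fine (\esum_(m in [set m : seq nat | size m = size k /\ path ltn 0%N m])
          (\prod_(p <- zip m k) (p.1%:R ^- p.2 : R))%:E)%E.

Definition index_add (k e : seq nat) : seq nat :=
  [seq (p.1 + p.2)%N | p <- zip k e].

(* The components of [e] with |e| = m are at most m, so it is enough to let
   them range over 'I_m.+1. *)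
Definition ohno_sum (R : realType) (m : nat) (k : seq nat) : R :=
  \sum_(e : (size k).-tuple 'I_m.+1 | sumn (map val e) == m)
    zeta R (index_add k (map val e)).

(* A power series in R[[X]] is its coefficient sequence; addition and
   subtraction are pointwise. *)
Definition power_series (R : realType) : zmodType := (nat -> R : zmodType).

Definition ohno (R : realType) (k : seq nat) : power_series R :=
  fun m => ohno_sum R m k.

(* A formal sum of indices is the list of its terms, repeated according to
   multiplicity. *)
Definition formal_sum : Type := seq (seq nat).

Definition ohno_lin (R : realType) (u : formal_sum) : power_series R :=
  \sum_(k <- u) ohno R k.

Fixpoint shuffle (k l : seq nat) {struct k} : formal_sum :=
  match k with
  | [::] => [:: l]
  | x :: k' =>
      (fix shuffle_k (l : seq nat) : formal_sum :=
         match l with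
         | [::] => [:: k]
         | y :: l' => map (cons x) (shuffle k' l) ++ map (cons y) (shuffle_k l')
         end) l
  end.

(* [:: (a_1, b_1); ...; (a_l, b_l)] encodes the index
   ({1}^(a_1 - 1), b_1 + 1, ..., {1}^(a_l - 1), b_l + 1). *)
Definition of_blocks (w : seq (nat * nat)) : seq nat :=
  flatten [seq rcons (nseq p.1.-1 1%N) p.2.+1 | p <- w].

Definition pos_blocks (w : seq (nat * nat)) : bool :=
  all (fun p => (0 < p.1) && (0 < p.2))%N w.

(* [a] is one more than the number of 1's read since the last component
   different from 1. *)
Fixpoint blocks_from (a : nat) (k : seq nat) : seq (nat * nat) :=
  match k with
  | [::] => [::]
  | x :: k' => if x == 1%N then blocks_from a.+1 k'
               else (a, x.-1) :: blocks_from 1 k'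
  end.

Definition blocks (k : seq nat) : seq (nat * nat) := blocks_from 1 k.

Definition dual (k : seq nat) : seq nat :=
  of_blocks (rev [seq (p.2, p.1) | p <- blocks k]).

Definition F (R : realType) (s : nat) (k : seq nat) : power_series R :=
  ohno_lin R (shuffle [:: s] k) - ohno_lin R (shuffle [:: s] (dual k)).

Lemma blocks_from_nseq a n k :
  blocks_from a (nseq n 1%N ++ k) = blocks_from (n + a) k.
Proof. by elim: n a => [|n IH] a //=; rewrite IH addnS. Qed.

Lemma pos_blocks_from a k : (0 < a)%N -> all (fun x => 0 < x)%N k ->
  pos_blocks (blocks_from a k).
Proof.
elim: k a => [|x k IH] a //= a0 /andP[x0 k0].
case: eqP => [_|/eqP x1]; first exact: IH.
by rewrite /= a0 IH // andbT; case: x x0 x1 => [|[|x]].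
Qed.

(* Existence and uniqueness of the block decomposition. *)
Lemma pos_blocks_blocks k : admissible k -> pos_blocks (blocks k).
Proof. by case/and3P => _ k0 _; apply: pos_blocks_from. Qed.

Lemma blocksK k : admissible k -> of_blocks (blocks k) = k.
Proof.
suff H a : admissible k -> of_blocks (blocks_from a.+1 k) = nseq a 1%N ++ k.
  by move=> adm; rewrite /blocks (H 0%N adm).
rewrite /admissible; elim: k a => [|x k IH] a //= /andP[/andP[x0 k0] lk].
case: k IH k0 lk => [|y k] IH k0 lk.
  by case: x x0 lk => [|[|x]] //= _ _; rewrite /of_blocks /= cats0 cats1.
have E b := IH b (introT andP (conj k0 lk)).
have [->|x1] := eqVneq x 1%N; last first.
  by rewrite /of_blocks map_cons [LHS]/= -/(of_blocks _) (E 0%N) prednK // cat_rcons.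
by rewrite E; elim: a => [|a] //= ->.
Qed.

Lemma of_blocksK w : pos_blocks w -> blocks (of_blocks w) = w.
Proof.
elim: w => [|[a b] w IH] //= /andP[/andP[/= a0 b0] w0].
rewrite /of_blocks /= -/(of_blocks w) /blocks cat_rcons blocks_from_nseq.
by rewrite addn1 prednK //; case: b b0 => //= b _; rewrite -/(blocks _) IH.
Qed.

Lemma dual_of_blocks w : pos_blocks w ->
  dual (of_blocks w) = of_blocks (rev [seq (p.2, p.1) | p <- w]).
Proof. by move=> w0; rewrite /dual of_blocksK. Qed.

Lemma dual_single t : (0 < t)%N -> dual [:: t.+1] = rcons (nseq t.-1 1%N) 2.
Proof. by case: t => // t _; rewrite /dual /of_blocks /= cats0. Qed.

Lemma shuffle_example a b c :
  shuffle [:: a] [:: b; c] = [:: [:: a; b; c]; [:: b; a; c]; [:: b; c; a]].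
Proof. by []. Qed.

(* Main.v *)
Require Import Defs.
From HB Require Import structures.
From mathcomp Require Import all_boot all_order all_algebra.
From mathcomp Require Import all_classical all_reals all_analysis.
From mathcomp Require Import ring lra.

(* Fix [0 <= X < 1].  Summing the geometric series in each component turns
   [O(k)] into the nested sum of the weights [n^(1 - k_i) / (n - X)].

   The product of the single sum [O(s)] with the nested sum [O(k)] is the
   shuffle sum plus the diagonal terms, in which the weight of [s] multiplies
   one weight of [k].  As [O(t+1) = O({1}^(t-1),2)], the shuffle sums in
   [F(s;(t+1))] reduce to diagonal terms; those of [(t+1)] are symmetric in [s]
   and [t], so it remains to prove [G(s,t) = G(t,s)] for the diagonal terms
   [G(s,t)] of [({1}^(t-1),2)].

   Both satisfy a recursion with the same cyclic sum [C(s,t)]: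
     [G(s,t) = C(s,t) + X G(s+1,t)] and [G(t,s) = C(s,t) + X G(t,s+1)].
   The first one comes from the connector [prod_(j <= m) (j-X)/(j+b-X)] of Seki
   and Yamamoto, the second one from the partial fraction argument that
   Hoffman and Ohno used for the cyclic sum formula.  Hence
   [G(s,t) - G(t,s) = X (G(s+1,t) - G(t,s+1))], and comparing coefficients of
   powers of [X] shows by induction that they all vanish. *)

Set Implicit Arguments.
Unset Strict Implicit.
Unset Printing Implicit Defensive.

Import Order.TTheory GRing.Theory Num.Theory.
Import numFieldNormedType.Exports.

Local Open Scope classical_set_scope.
Local Open Scope ring_scope.

(** * The semiring of nonnegative extended reals *)

(* In this commutative semiring infinite sums may be exchanged without
   summability hypotheses; finiteness only matters for cancellation. *)
Record ennreal (R : realType) := Ennreal {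
  ennval :> \bar R;
  ennval_ge0 : (0 <= ennval)%E }.

Arguments Ennreal {R} _ _.

HB.instance Definition _ (R : realType) := [isSub for @ennval R].
HB.instance Definition _ (R : realType) := [Choice of ennreal R by <:].

Section Semiring.
Variable R : realType.
Implicit Types x y z : ennreal R.

Definition enn_add x y :=
  Ennreal (x + y)%E (adde_ge0 (ennval_ge0 x) (ennval_ge0 y)).
Definition enn_mul x y :=
  Ennreal (x * y)%E (mule_ge0 (ennval_ge0 x) (ennval_ge0 y)).
Definition enn_zero : ennreal R := Ennreal 0%E (lexx _).
Definition enn_one : ennreal R := Ennreal 1%E lee01.

Fact enn_addA : associative enn_add.
Proof. by move=> x y z; apply: val_inj; rewrite /= addeA. Qed.
Fact enn_addC : commutative enn_add.
Proof. by move=> x y; apply: val_inj; rewrite /= addeC. Qed.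
Fact enn_add0 : left_id enn_zero enn_add.
Proof. by move=> x; apply: val_inj; rewrite /= add0e. Qed.
Fact enn_mulA : associative enn_mul.
Proof. by move=> x y z; apply: val_inj; rewrite /= muleA. Qed.
Fact enn_mulC : commutative enn_mul.
Proof. by move=> x y; apply: val_inj; rewrite /= muleC. Qed.
Fact enn_mul1 : left_id enn_one enn_mul.
Proof. by move=> x; apply: val_inj; rewrite /= mul1e. Qed.
Fact enn_mulDl : left_distributive enn_mul enn_add.
Proof. by move=> x y z; apply: val_inj; rewrite /= ge0_muleDl// ennval_ge0. Qed.
Fact enn_mul0 : left_zero enn_zero enn_mul.
Proof. by move=> x; apply: val_inj; rewrite /= mul0e. Qed.

HB.instance Definition _ := GRing.isNmodule.Build (ennreal R)
  enn_addA enn_addC enn_add0.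
HB.instance Definition _ := GRing.Nmodule_isComPzSemiRing.Build (ennreal R)
  enn_mulA enn_mulC enn_mul1 enn_mulDl enn_mul0.

Lemma ennvalD x y : (x + y : ennreal R) = (x + y)%E :> \bar R. Proof. by []. Qed.
Lemma ennvalM x y : (x * y : ennreal R) = (x * y)%E :> \bar R. Proof. by []. Qed.
Lemma ennval0 : (0 : ennreal R) = 0%E :> \bar R. Proof. by []. Qed.

End Semiring.

(** * Embedding of the reals and infinite sums *)

Section RealEmbedding.
Variable R : realType.
Implicit Types (a b : R) (x y z : ennreal R).

(* Junk value: negative reals are sent to [0]. *)
Definition enn a : ennreal R :=
  @Ennreal R (Num.max 0 a)%:E (ltac:(by rewrite lee_fin le_max lexx)).

Lemma ennE a : 0 <= a -> enn a = a%:E :> \bar R.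
Proof. by move=> a0; rewrite /= max_r. Qed.

Lemma ennD a b : 0 <= a -> 0 <= b -> enn (a + b) = enn a + enn b.
Proof.
by move=> a0 b0; apply: val_inj; rewrite /= !max_r ?addr_ge0.
Qed.

Lemma ennM a b : 0 <= a -> 0 <= b -> enn (a * b) = enn a * enn b.
Proof.
by move=> a0 b0; apply: val_inj; rewrite /= !max_r ?mulr_ge0.
Qed.

Lemma enn0 : enn 0 = 0. Proof. by apply: val_inj; rewrite /= maxxx. Qed.
Lemma enn1 : enn 1 = 1. Proof. by apply: val_inj; rewrite /= max_r. Qed.

Lemma enn_nat n : enn n%:R = n%:R.
Proof.
elim: n => [|n IH]; first exact: enn0.
by rewrite -addn1 !natrD ennD// IH enn1.
Qed.

Lemma ennX a n : 0 <= a -> enn (a ^+ n) = enn a ^+ n.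
Proof.
move=> a0; elim: n => [|n IH]; first by rewrite !expr0 enn1.
by rewrite !exprS ennM ?exprn_ge0// IH.
Qed.

Lemma enn_inj a b : 0 <= a -> 0 <= b -> enn a = enn b -> a = b.
Proof.
by move=> a0 b0 /(congr1 (@ennval R)); rewrite !ennE// => -[].
Qed.

Lemma enn_sum I (s : seq I) (P : pred I) (F : I -> R) :
  (forall i, P i -> 0 <= F i) ->
  enn (\sum_(i <- s | P i) F i) = \sum_(i <- s | P i) enn (F i).
Proof.
move=> F0; elim: s => [|i s IH]; first by rewrite !big_nil enn0.
rewrite !big_cons; case: ifP => // Pi.
by rewrite ennD ?IH ?F0// sumr_ge0.
Qed.

Definition enn_fin x : bool := (x < +oo :> \bar R)%E.

Lemma enn_fin_enn a : enn_fin (enn a). Proof. exact: ltry. Qed.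

Lemma enn_fin_num x : enn_fin x -> ennval x \is a fin_num.
Proof. by move=> xf; rewrite ge0_fin_numE ?ennval_ge0. Qed.

Lemma enn_fineK x : enn_fin x -> enn (fine x) = x.
Proof.
move=> xf; apply: val_inj; rewrite [LHS]ennE ?fine_ge0 ?ennval_ge0//.
by rewrite fineK ?enn_fin_num.
Qed.

Lemma enn_fin_le x y : (x <= y :> \bar R)%E -> enn_fin y -> enn_fin x.
Proof. exact: le_lt_trans. Qed.

Lemma enn_leDl x y : (ennval x <= ennval (x + y)%R)%E.
Proof. by rewrite ennvalD leeDl ?ennval_ge0. Qed.

Lemma enn_leD x y x' y' : (x <= x' :> \bar R)%E -> (y <= y' :> \bar R)%E ->
  (ennval (x + y)%R <= ennval (x' + y')%R)%E.
Proof. by move=> ? ?; rewrite !ennvalD leeD. Qed.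

Lemma enn_leM x y x' y' : (x <= x' :> \bar R)%E -> (y <= y' :> \bar R)%E ->
  (ennval (x * y)%R <= ennval (x' * y')%R)%E.
Proof. by move=> ? ?; rewrite !ennvalM lee_pmul ?ennval_ge0. Qed.

Lemma enn_le a b : a <= b -> (enn a <= enn b :> \bar R)%E.
Proof. by move=> ab; rewrite /= lee_fin ge_max !le_max lexx ab orbT. Qed.

Lemma enn_finD x y : enn_fin (x + y) = enn_fin x && enn_fin y.
Proof.
apply/idP/andP => [xy|[xf yf]]; last by rewrite /enn_fin ennvalD lte_add_pinfty.
split; first exact: enn_fin_le (enn_leDl x y) xy.
by rewrite addrC in xy; exact: enn_fin_le (enn_leDl y x) xy.
Qed.

Lemma enn_finM x y : enn_fin x -> enn_fin y -> enn_fin (x * y).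
Proof.
by move=> /enn_fineK <- /enn_fineK <-; rewrite -ennM ?fine_ge0 ?ennval_ge0 ?enn_fin_enn.
Qed.

Lemma enn_addIr z x y : enn_fin z -> x + z = y + z -> x = y.
Proof.
move=> zf /(congr1 (@ennval R)); rewrite !ennvalD => e; apply: val_inj.
have zn := enn_fin_num zf.
by rewrite /= -(addeK (ennval x) zn) e addeK.
Qed.

Lemma enn_mulVK a x : 0 < a -> enn a^-1 * (enn a * x) = x.
Proof.
move=> a0; rewrite mulrA -ennM ?invr_ge0 ?ltW// mulVf ?gt_eqF// enn1 mul1r //.
Qed.

End RealEmbedding.

Section Sums.
Variable R : realType.
Local Notation E := (ennreal R).

Definition tsum (T : choiceType) (f : T -> E) : E :=
  @Ennreal R (\esum_(i in [set: T]) ennval (f i))%E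
    (esum_ge0 (fun i _ => ennval_ge0 (f i))).

Lemma eq_tsum (T : choiceType) (f g : T -> E) : f =1 g -> tsum f = tsum g.
Proof. by move=> /funext ->. Qed.

Lemma tsumD (T : choiceType) (f g : T -> E) :
  tsum (fun i => f i + g i) = tsum f + tsum g.
Proof. by apply: val_inj; rewrite /= esumD// => i _; apply: ennval_ge0. Qed.

Lemma le_tsum (T : choiceType) (f g : T -> E) :
  (forall i, (f i <= g i :> \bar R)%E) -> (tsum f <= tsum g :> \bar R)%E.
Proof. by move=> fg; apply: le_esum. Qed.

Lemma tsum0 (T : choiceType) (f : T -> E) : (forall i, f i = 0) -> tsum f = 0.
Proof. by move=> f0; apply: val_inj; rewrite /= esum1// => i _; rewrite f0. Qed.

Lemma tsum_ge (T : choiceType) (f : T -> E) i : (f i <= tsum f :> \bar R)%E.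
Proof.
rewrite [leRHS]/= (esumID [set i])// => [|j _]; last exact: ennval_ge0.
rewrite setTI esum_set1 ?ennval_ge0// leeDl// esum_ge0// => j _.
exact: ennval_ge0.
Qed.

(** The bound [le] holds for every factor. For a finite nonzero [c] the reverse bound is [le] for
    the inverse factor; an infinite [c] makes both sides infinite unless all [f i] vanish. *)
Lemma tsumZl (T : choiceType) c (f : T -> E) :
  tsum (fun i => c * f i) = c * tsum f.
Proof.
have le (a : E) (g : T -> E) : (ennval (tsum (fun i => a * g i)%R) <= ennval (a * tsum g)%R)%E.
  rewrite /= ge_ereal_sup// => _ [X [finX _]] <-.
  rewrite -ge0_mule_fsumr => [|i]; last exact: ennval_ge0.
  by rewrite lee_pmul ?ennval_ge0 ?fsume_ge0 ?esum_ge// => [i _|]; [apply: ennval_ge0|exists X].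
have [cf|cn] := boolP (enn_fin c); last first.
  have coo : c = +oo%E :> \bar R.
    by apply/eqP; move: cn; rewrite /enn_fin -leNgt leye_eq.
  have [f0|] := pselect (forall i, f i = 0).
    by rewrite !tsum0 ?mulr0// => i; rewrite f0 mulr0.
  move=> /existsNP[i fi].
  have fi0 : (0 < ennval (f i))%E.
    by rewrite lt_def ennval_ge0 andbT; apply/eqP => fi0; apply/fi/val_inj.
  have e (z : E) : (0 < z :> \bar R)%E -> (c * z : E) = +oo%E :> \bar R.
    by move=> z0; rewrite ennvalM coo gt0_mulye.
  apply: val_inj; rewrite [RHS]e; last exact: lt_le_trans fi0 (tsum_ge f i).
  by apply/eqP; rewrite -leye_eq -(e _ fi0) (tsum_ge (fun i => c * f i)).
have [c0|c0] := eqVneq c 0.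
  by rewrite c0 mul0r tsum0// => i; rewrite mul0r.
apply: val_inj; apply/eqP; rewrite eq_le le /=.
have a0 : (0 < fine c).
  apply: fine_gt0; apply/andP; split => //; rewrite lt_def ennval_ge0 andbT.
  by apply: contra c0 => /eqP c0; apply/eqP/val_inj.
move: (fine c) a0 (enn_fineK cf) => a a0 <-.
have := @enn_leM R (enn a) _ (enn a) _ (lexx _)
  (le (enn a^-1) (fun i => enn a * f i)).
rewrite [X in tsum X](_ : _ = f); last by apply/funext => i; rewrite enn_mulVK.
by rewrite -{2}[a]invrK enn_mulVK ?invr_gt0.
Qed.

Lemma tsumZr (T : choiceType) c (f : T -> E) :
  tsum (fun i => f i * c) = tsum f * c.
Proof. by rewrite mulrC -tsumZl; apply: eq_tsum => i; rewrite mulrC. Qed.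

Lemma tsum_sum (T : choiceType) I (s : seq I) (f : I -> T -> E) :
  tsum (fun t => \sum_(i <- s) f i t) = \sum_(i <- s) tsum (f i).
Proof.
elim: s => [|i s IH]; first by rewrite big_nil tsum0// => t; rewrite big_nil.
by rewrite big_cons -IH -tsumD; apply: eq_tsum => t; rewrite big_cons.
Qed.

Lemma tsum_pair (T U : choiceType) (f : T * U -> E) :
  tsum f = tsum (fun i => tsum (fun j => f (i, j))).
Proof.
apply: val_inj; rewrite /= (esum_esum (a := fun i j => ennval (f (i, j))))//.
  rewrite (_ : _ `*`` _ = [set: T * U]); first by apply: eq_esum => -[].
  by apply/seteqP; split.
by move=> i j _ _; apply: ennval_ge0.
Qed.

Lemma tsum_inj (T U : choiceType) (h : U -> T) (f : T -> E) : injective h ->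
  (forall t, ~ (exists u, h u = t) -> f t = 0) -> tsum f = tsum (f \o h).
Proof.
move=> hi f0; apply: val_inj => /=.
rewrite -(@esum_image R _ _ setT h (fun t => ennval (f t))); last by move=> x y _ _ /hi.
rewrite [RHS]esum_mkcond; apply: eq_esum => t _.
case: ifPn => // /negP; rewrite inE => tN; rewrite f0 ?ennval0// => -[u uE].
by apply: tN; exists u.
Qed.

Lemma tsum_exchange (T U : choiceType) (f : T -> U -> E) :
  tsum (fun i => tsum (fun j => f i j)) = tsum (fun j => tsum (fun i => f i j)).
Proof.
rewrite -(tsum_pair (fun p => f p.1 p.2)) -(tsum_pair (fun p => f p.2 p.1)).
rewrite (@tsum_inj _ _ (fun p : U * T => (p.2, p.1)))//.
  by move=> [a b] [c d] [-> ->].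
by move=> [a b]; case; exists (b, a).
Qed.

Lemma tsum_delta (T : choiceType) (i : T) (f : T -> E) :
  tsum (fun j => (j == i)%:R * f j) = f i.
Proof.
rewrite (@tsum_inj _ unit (fun=> i)); first last.
- by move=> t tN; case: eqP => [ti|_]; [case: tN; exists tt|rewrite mul0r].
- by move=> [] [].
apply: val_inj => /=.
rewrite (_ : [set: unit] = [set tt]) ?esum_set1 /= ?eqxx ?mul1e ?ennval_ge0//.
by apply/seteqP; split => // -[].
Qed.

Lemma tsum_fin (T : finType) (f : T -> E) : tsum f = \sum_i f i.
Proof.
transitivity (tsum (fun j => \sum_i (j == i)%:R * f j)).
  apply: eq_tsum => j; rewrite (bigD1 j)//= eqxx mul1r big1 ?addr0// => i ij.
  by rewrite eq_sym (negPf ij) mul0r.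
by rewrite tsum_sum; apply: eq_bigr => i _; rewrite tsum_delta.
Qed.

Lemma tsum_recl (f : nat -> E) : tsum f = f 0%N + tsum (fun n => f n.+1).
Proof.
transitivity (tsum (fun n => (n == 0%N)%:R * f n + (0 < n)%:R * f n)).
  by apply: eq_tsum => -[|n]; rewrite /= mul1r mul0r ?addr0 ?add0r.
rewrite tsumD tsum_delta; congr (_ + _).
rewrite (@tsum_inj _ _ succn); first by apply: eq_tsum => n; rewrite /= mul1r.
  exact: succn_inj.
by move=> [|n]; rewrite ?mul0r//; case; exists n.
Qed.

Lemma tsum_seq (T : choiceType) (f : seq T -> E) :
  tsum f = f [::] + tsum (fun i => tsum (fun e => f (i :: e))).
Proof.
transitivity (tsum (fun e => (e == [::])%:R * f e + (e != [::])%:R * f e)).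
  by apply: eq_tsum => e; case: eqVneq; rewrite mul1r mul0r ?addr0 ?add0r.
rewrite tsumD tsum_delta; congr (_ + _).
rewrite (@tsum_inj _ _ (fun p : T * seq T => p.1 :: p.2)).
- by rewrite tsum_pair; apply: eq_tsum => i; apply: eq_tsum => e; rewrite /= mul1r.
- by move=> [a b] [c d] [-> ->].
- by move=> [|i e]; rewrite ?mul0r//; case; exists (i, e).
Qed.

Lemma tsum_mul (T U : choiceType) (f : T -> E) (g : U -> E) :
  tsum f * tsum g = tsum (fun i => tsum (fun j => f i * g j)).
Proof. by rewrite -tsumZr; apply: eq_tsum => i; rewrite tsumZl. Qed.

Lemma tsum_telescope (u : nat -> R) : (forall n, u n.+1 <= u n) ->
  u @ \oo --> (0 : R) -> tsum (fun n => enn (u n - u n.+1)) = enn (u 0%N).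
Proof.
move=> ud u0.
have ui n : u n <= u 0%N by elim: n => // n; apply: le_trans.
have u0_ge0 : 0 <= u 0%N.
  by rewrite -(cvg_lim _ u0)//; apply: limr_le; [apply: cvgP u0|apply: nearW].
apply: val_inj; rewrite [RHS]ennE//= -nneseries_esumT; last first.
  by move=> n; exact: (ennval_ge0 (enn (u n - u n.+1))).
apply: cvg_lim => //.
rewrite (_ : (fun n => _) = EFin \o (fun n => u 0%N - u n)); last first.
  apply/funext => n /=.
  under eq_bigr do rewrite max_r ?subr_ge0//.
  rewrite sumEFin; congr (_%:E).
  rewrite -[RHS]opprB -(telescope_sumr u (leq0n n)) -sumrN.
  by apply: eq_bigr => i _; rewrite opprB.
apply: cvg_EFin; first exact: nearW.
by rewrite -[u 0%N in X in _ --> X]subr0; apply: cvgB => //; exact: cvg_cst.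
Qed.

Lemma tsum_geometric (x : R) : 0 <= x -> x < 1 ->
  tsum (fun n => enn x ^+ n) = enn (1 - x)^-1.
Proof.
move=> x0 x1; have x1' : 0 < 1 - x by rewrite subr_gt0.
rewrite -[RHS](_ : enn (x ^+ 0 / (1 - x)) = _); last by rewrite expr0 mul1r.
rewrite -(@tsum_telescope (fun n => x ^+ n / (1 - x))).
- apply: eq_tsum => n; rewrite -ennX//; congr enn.
  by rewrite exprS; field; rewrite gt_eqF.
- move=> n; rewrite ler_pM2r ?invr_gt0// exprS ler_piMl ?exprn_ge0//; exact: ltW.
rewrite -[X in _ --> X](mul0r (1 - x)^-1); apply: cvgMl.
by apply: cvg_expr; rewrite ger0_norm.
Qed.

End Sums.

(** * Nested sums and the generating series of Ohno sums *)

Section NestedSums.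
Variable R : realType.
Local Notation E := (ennreal R).
Implicit Types (w : nat -> nat -> E) (f g : nat -> E) (a : nat) (k : seq nat).

Definition tail f a : E := tsum (fun n => (a < n)%:R * f n).

(** The bound [a] lies below the smallest summation variable, which belongs to the head of [k]. *)
Fixpoint nest w k a : E :=
  if k is x :: k' then tail (fun n => w x n * nest w k' n) a else 1.

Lemma eq_tail f g a : (forall n, (a < n)%N -> f n = g n) -> tail f a = tail g a.
Proof.
by move=> fg; apply: eq_tsum => n; case: ltnP => [/fg ->|]; rewrite ?mul0r.
Qed.

Lemma tailD f g a : tail (fun n => f n + g n) a = tail f a + tail g a.
Proof. by rewrite /tail -tsumD; apply: eq_tsum => n; rewrite mulrDr. Qed.

Lemma tailZ c f a : tail (fun n => c * f n) a = c * tail f a.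
Proof. by rewrite /tail -tsumZl; apply: eq_tsum => n; rewrite mulrCA. Qed.

Lemma tail_tsum (T : choiceType) (F : T -> nat -> E) a :
  tail (fun n => tsum (fun t => F t n)) a = tsum (fun t => tail (F t) a).
Proof.
rewrite /tail tsum_exchange; apply: eq_tsum => n.
by rewrite tsumZl.
Qed.

Lemma eq_nest w w' k a :
  (forall x n, (0 < n)%N -> w x n = w' x n) -> nest w k a = nest w' k a.
Proof.
move=> ww; elim: k a => [|x k IH] a //=; apply: eq_tail => n an.
by rewrite IH ww//; case: n an.
Qed.

Lemma nestE w k a :
  nest w k a = tsum (fun m : seq nat => ((size m == size k) && path ltn a m)%:R *
                       \prod_(p <- zip m k) w p.2 p.1).
Proof.
elim: k a => [|x k IH] a.
  rewrite tsum_seq /= big_nil mul1r tsum0 ?addr0// => i.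
  by rewrite tsum0// => e; rewrite mul0r.
rewrite tsum_seq /= mul0r add0r; apply: eq_tsum => i.
rewrite IH -!tsumZl; apply: eq_tsum => m /=.
rewrite eqSS big_cons /=.
by case: (size m == _); case: (_ < _)%N; case: path => /=; ring.
Qed.

(** The power x^|e| factors over the components of [e], so the sum over each component moves into
    the weight of that component. *)
Lemma nest_index_add w (x : E) k a :
  tsum (fun e => (size e == size k)%:R * (x ^+ sumn e * nest w (index_add k e) a)) =
  nest (fun y n => tsum (fun i => x ^+ i * w (y + i)%N n)) k a.
Proof.
elim: k a => [|y k IH] a.
  rewrite tsum_seq /= !mul1r tsum0 ?addr0// => i.
  by rewrite tsum0// => e; rewrite mul0r.
rewrite tsum_seq /= mul0r add0r.
under eq_tsum => i.
  rewrite (_ : tsum _ = tail (fun n => x ^+ i * w (y + i)%N n *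
      nest (fun y n => tsum (fun i => x ^+ i * w (y + i)%N n)) k n) a); last first.
    under [in RHS]eq_tail => n an do rewrite -IH -tsumZl.
    rewrite tail_tsum; apply: eq_tsum => e.
    rewrite mulrA -tailZ; apply: eq_tail => n _.
    by rewrite /= eqSS exprD; ring.
  over.
by rewrite -tail_tsum; apply: eq_tail => n _; rewrite tsumZr.
Qed.

End NestedSums.

Section GeneratingSeries.
Variable R : realType.
Local Notation E := (ennreal R).

Definition recip (n : nat) : E := enn (n%:R^-1).

Definition power_weight (k n : nat) : E := recip n ^+ k.

Lemma recipE n : (0 < n)%N -> n%:R * recip n = 1.
Proof.
move=> n0; rewrite -enn_nat -ennM ?invr_ge0 ?ler0n// divff ?enn1//.
by rewrite pnatr_eq0 -lt0n.
Qed.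

Lemma zeta_ge0 k : 0 <= zeta R k.
Proof.
by rewrite fine_ge0// esum_ge0// => m _; rewrite lee_fin prodr_ge0.
Qed.

(** [fine] sends a divergent series to 0, hence the finiteness hypothesis. *)
Lemma zetaE k : enn_fin (nest power_weight k 0) ->
  enn (zeta R k) = nest power_weight k 0.
Proof.
move=> fin; rewrite -[RHS](enn_fineK fin) /zeta; congr (enn (fine _)).
rewrite nestE /= esum_mkcond; apply: eq_esum => m _.
have -> : \prod_(p <- zip m k) power_weight p.2 p.1 =
          enn (\prod_(p <- zip m k) (p.1%:R ^- p.2 : R)).
  elim: (zip m k) => [|p l IH]; first by rewrite !big_nil enn1.
  rewrite !big_cons IH [in RHS]ennM; last 2 first.
  - by rewrite invr_ge0 exprn_ge0.
  - by rewrite prodr_ge0// => i _; rewrite invr_ge0 exprn_ge0.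
  by rewrite /power_weight /recip -exprVn ennX// invr_ge0.
rewrite -[in LHS]ennE; last first.
  by rewrite prodr_ge0// => i _; rewrite invr_ge0 exprn_ge0.
have -> : (m \in [set m | size m = size k /\ path ltn 0%N m]) =
          (size m == size k) && path ltn 0%N m.
  by apply/idP/andP; rewrite inE /= => -[/eqP].
by case: ifP => _; rewrite /= ?mul1e ?mul0e.
Qed.

Lemma sum_tuples (Z : seq nat -> E) (r m : nat) :
  \sum_(e : r.-tuple 'I_m.+1 | sumn (map val e) == m) Z (map val e) =
  tsum (fun e => ((size e == r) && (sumn e == m))%:R * Z e).
Proof.
rewrite (@tsum_inj _ _ _ (fun e : r.-tuple 'I_m.+1 => map val e)); last 2 first.
- by move=> e e' /(inj_map val_inj) /val_inj.
- move=> e eN; case: andP => [[/eqP er /eqP em]|_]; last by rewrite mul0r.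
  case: eN; have em' : map val [seq inord i : 'I_m.+1 | i <- e] = e.
    rewrite -map_comp -[RHS]map_id; apply/eq_in_map => i ie /=.
    rewrite inordK// ltnS -em.
    elim: e ie {er em} => //= j e IH; rewrite inE => /orP[/eqP <-|/IH].
      exact: leq_addr.
    by move/leq_trans; apply; apply: leq_addl.
  have sz : size [seq inord i : 'I_m.+1 | i <- e] == r by rewrite size_map er.
  by exists (Tuple sz).
rewrite tsum_fin big_mkcond; apply: eq_bigr => e _ /=.
by rewrite size_map size_tuple eqxx; case: ifP; rewrite ?mul1r ?mul0r.
Qed.

Lemma ohno_sum_ge0 m k : 0 <= ohno_sum R m k.
Proof. by apply: sumr_ge0 => e _; apply: zeta_ge0. Qed.

Lemma ohno_generating (X : R) k : 0 < X ->
  let S := nest (fun y n => tsum (fun i => enn X ^+ i * power_weight (y + i) n)) k 0 in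
  enn_fin S -> tsum (fun m => enn X ^+ m * enn (ohno_sum R m k)) = S.
Proof.
move=> X0 S Sfin; rewrite /S -nest_index_add.
set Z := fun e => nest power_weight (index_add k e) 0.
(* As X > 0, the term X^|e| [Z e] of the finite sum [S] can be divided by X^|e|, so each zeta series
   is finite. *)
have Zfin e : size e = size k -> enn_fin (Z e).
  move=> ek; rewrite -[Z e](@enn_mulVK _ (X ^+ sumn e)) ?exprn_gt0//.
  apply: enn_finM; first exact: enn_fin_enn.
  apply: enn_fin_le Sfin; rewrite /S -nest_index_add.
  apply: le_trans (tsum_ge _ e).
  by rewrite ek eqxx mul1r ennX// ltW.
under eq_tsum => m.
  rewrite (_ : enn (ohno_sum R m k) =
    tsum (fun e => ((size e == size k) && (sumn e == m))%:R * Z e)); last first.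
    rewrite -sum_tuples enn_sum => [|e _]; last exact: zeta_ge0.
    apply: eq_bigr => e _; rewrite zetaE//.
    by apply: Zfin; rewrite size_map size_tuple.
  rewrite -tsumZl; over.
rewrite tsum_exchange; apply: eq_tsum => e.
rewrite -/(Z e) -[X in _ = _ * X](tsum_delta (sumn e) (fun m => enn X ^+ m * Z e)).
rewrite -tsumZl; apply: eq_tsum => m; rewrite (eq_sym m).
by case: (size e == _); case: (sumn e == m) => /=; ring.
Qed.

End GeneratingSeries.

(** * Coefficients of a power series from its values on (0, 1) *)

Section PowerSeriesUniqueness.
Variable R : realType.
Local Notation E := (ennreal R).

(** For X <= 1/2 the series of [v] without its constant term is at most X C, where C is the shifted
    series at 1/2. A small X then gives the inequality. *)
Lemma power_series_head_le (u v : nat -> R) :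
  (forall n, 0 <= u n) -> (forall n, 0 <= v n) ->
  (forall X : R, 0 < X < 1 ->
     enn_fin (tsum (fun m => enn X ^+ m * enn (v m))) /\
     tsum (fun m => enn X ^+ m * enn (u m)) = tsum (fun m => enn X ^+ m * enn (v m))) ->
  u 0%N <= v 0%N.
Proof.
move=> u0 v0 H.
have recl w X : 0 <= X -> tsum (fun m => enn X ^+ m * enn (w m)) =
    enn (w 0%N) + enn X * tsum (fun m => enn X ^+ m * enn (w m.+1)) :> E.
  move=> X0; rewrite tsum_recl expr0 mul1r -tsumZl; congr (_ + _).
  by apply: eq_tsum => m; rewrite exprS mulrA.
have h0 : 0 < 2^-1 :> R by rewrite invr_gt0.
pose Rv := tsum (fun m => enn 2^-1 ^+ m * enn (v m.+1)).
have Rvfin : enn_fin Rv.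
  rewrite -[Rv](@enn_mulVK _ 2^-1)//; apply: enn_finM; first exact: enn_fin_enn.
  have [|+ _] := H 2^-1; first by rewrite h0/= invf_lt1// ltr1n.
  by rewrite recl ?ltW// enn_finD => /andP[].
pose C : R := fine Rv.
have C0 : 0 <= C by rewrite fine_ge0 ?ennval_ge0.
have le X : 0 < X -> X <= 2^-1 -> u 0%N <= v 0%N + X * C.
  move=> X0 X1.
  have [|_] := H X; first by rewrite X0 (le_lt_trans X1)// invf_lt1// ltr1n.
  rewrite (recl u) ?(ltW X0)// (recl v) ?(ltW X0)// => e.
  have : (ennval (enn (u 0%N)) <= ennval (enn (v 0%N) + enn X * enn C)%R)%E.
    apply: le_trans (enn_leDl _ (enn X * tsum (fun m => enn X ^+ m * enn (u m.+1)))) _.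
    rewrite e; apply: enn_leD => //.
    apply: enn_leM => //; rewrite enn_fineK//.
    apply: le_tsum => m; apply: enn_leM => //.
    by rewrite -!ennX ?(ltW h0) ?(ltW X0)// enn_le// lerXn2r// nnegrE ltW.
  rewrite -ennM ?(ltW X0)// -ennD ?mulr_ge0 ?(ltW X0)//.
  by rewrite !ennE ?addr_ge0 ?mulr_ge0 ?(ltW X0).
rewrite leNgt; apply/negP => vu.
pose d := u 0%N - v 0%N; have d0 : 0 < d by rewrite subr_gt0.
have C1 : 0 < C + 1 by rewrite ltr_wpDl.
have e0 : 0 < d / (C + 1) / 2 by rewrite !divr_gt0.
(* This X satisfies X C <= (d / 2) C / (C + 1) < d; the summand 1 keeps the denominator positive
   when C = 0. *)
have /= := le (Num.min 2^-1 (d / (C + 1) / 2)).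
rewrite lt_min h0 e0 ge_min lexx /= => /(_ isT isT).
apply/negP; rewrite -ltNge.
apply: (@le_lt_trans _ _ (v 0%N + d / (C + 1) / 2 * C)).
  by rewrite lerD2l ler_wpM2r// ge_min lexx orbT.
have : d / (C + 1) * (C + 1) = d by rewrite divfK ?gt_eqF.
have : 0 < d / (C + 1) by rewrite divr_gt0.
move: (d / (C + 1)) => y y0; have : 0 <= y * C by rewrite mulr_ge0// ltW.
rewrite /d; lra.
Qed.

(** Induction on the index: the equal constant terms cancel, and dividing by X shifts both
    series. *)
Lemma power_series_unique (u v : nat -> R) :
  (forall n, 0 <= u n) -> (forall n, 0 <= v n) ->
  (forall X : R, 0 < X < 1 ->
     enn_fin (tsum (fun m => enn X ^+ m * enn (v m))) /\
     tsum (fun m => enn X ^+ m * enn (u m)) = tsum (fun m => enn X ^+ m * enn (v m))) ->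
  u =1 v.
Proof.
move=> + + + n; elim: n u v => [|n IH] u v u0 v0 H.
  apply/eqP; rewrite eq_le; apply/andP; split; apply: power_series_head_le => // X X01.
  by have [? ->] := H X X01.
have uv0 : u 0%N = v 0%N.
  apply/eqP; rewrite eq_le; apply/andP; split; apply: power_series_head_le => // X X01.
  by have [? ->] := H X X01.
apply: (IH (fun n => u n.+1) (fun n => v n.+1)) => // X /[dup] X01 /andP[X0 _].
have [] := H X X01.
rewrite (tsum_recl (fun m => enn X ^+ m * enn (u m))).
rewrite (tsum_recl (fun m => enn X ^+ m * enn (v m))) !expr0 !mul1r uv0.
have sh w : tsum (fun m => enn X ^+ m.+1 * enn (w m.+1)) =
    enn X * tsum (fun m => enn X ^+ m * enn (w m.+1)) :> E.
  by rewrite -tsumZl; apply: eq_tsum => m; rewrite exprS mulrA.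
rewrite !sh enn_finD => /andP[_ fin]; rewrite ![enn (v 0%N) + _]addrC.
move=> /enn_addIr e; split.
  by rewrite -[tsum _](@enn_mulVK _ X)// enn_finM// enn_fin_enn.
by rewrite -[LHS](@enn_mulVK _ X)// -[RHS](@enn_mulVK _ X)// e// enn_fin_enn.
Qed.

End PowerSeriesUniqueness.

(** * Product of a single sum with a nested sum *)

Section ShuffleProduct.
Variable R : realType.
Local Notation E := (ennreal R).
Implicit Types (w : nat -> nat -> E) (f g v : nat -> E).

Lemma tailM f g a : tail f a * tail g a =
  tail (fun n => f n * tail g n) a + tail (fun n => g n * tail f n) a +
  tail (fun n => f n * g n) a.
Proof.
transitivity (tsum (fun i => tsum (fun j =>
    (a < i)%:R * (f i * ((i < j)%:R * g j)) + (a < j)%:R * (g j * ((j < i)%:R * f i)) +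
    (j == i)%:R * ((a < j)%:R * (f j * g j))))).
  rewrite tsum_mul; apply: eq_tsum => i; apply: eq_tsum => j.
  case: (ltngtP i j) => [ij|ji|<-].
  - case: (ltnP a i) => [ai|_]; last by rewrite !(mul0r, mulr0, addr0).
    by rewrite (ltn_trans ai ij) !(mul0r, mulr0, mul1r, addr0, add0r).
  - case: (ltnP a j) => [aj|_]; last by rewrite !(mul0r, mulr0, addr0).
    by rewrite (ltn_trans aj ji) !(mul0r, mulr0, mul1r, addr0, add0r) mulrC.
  - by case: (a < i)%N; rewrite !(mul0r, mulr0, mul1r, addr0, add0r).
under eq_tsum do rewrite tsumD tsum_delta tsumD tsumZl tsumZl.
rewrite tsumD tsumD; congr (_ + _ + _).
rewrite tsum_exchange; apply: eq_tsum => j.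
by rewrite tsumZl tsumZl.
Qed.

Lemma tail_sum I (s : seq I) (F : I -> nat -> E) a :
  tail (fun n => \sum_(i <- s) F i n) a = \sum_(i <- s) tail (F i) a.
Proof.
rewrite -tsum_sum; apply: eq_tsum => n.
by rewrite big_distrr.
Qed.

(* The diagonal terms of the product of the single sum of [v] with the nested
   sum of [k]. *)
Fixpoint mark v w (k : seq nat) a : E :=
  if k is y :: k' then
    tail (fun n => w y n * (v n * nest w k' n + mark v w k' n)) a
  else 0.

Lemma nest_cons w x k a :
  nest w (x :: k) a = tail (fun n => w x n * nest w k n) a.
Proof. by []. Qed.

Lemma mark_cons v w y k a : mark v w (y :: k) a =
  tail (fun n => w y n * (v n * nest w k n + mark v w k n)) a.
Proof. by []. Qed.

(** [tailM] compares the variable of [s] with the first variable of [k]. If it is smaller, [s] comes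
    first in the shuffle; if it is larger, the induction hypothesis applies above the first variable
    of [k]; equality gives the first term of [mark]. *)
Lemma nest_shuffle w s k a : nest w [:: s] a * nest w k a =
  \sum_(l <- shuffle [:: s] k) nest w l a + mark (w s) w k a.
Proof.
elim: k a => [|y k IH] a; first by rewrite /= big_seq1 mulr1 addr0.
rewrite (_ : shuffle [:: s] (y :: k) =
  [:: s, y & k] :: map (cons y) (shuffle [:: s] k))// big_cons big_map.
have -> : \sum_(l <- shuffle [:: s] k) nest w (y :: l) a =
    tail (fun n => w y n * \sum_(l <- shuffle [:: s] k) nest w l n) a.
  by under [RHS]eq_tail => n _ do rewrite mulr_sumr; rewrite tail_sum.
rewrite nest_cons mark_cons -addrA -tailD !nest_cons tailM -addrA -tailD.
congr (_ + _); first by apply: eq_tail => n _; rewrite mulr1 nest_cons.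
apply: eq_tail => n _.
have IHn : tail (fun m => w s m * nest w [::] m) n * nest w k n = _ := IH n.
rewrite -mulrA [nest w k n * _]mulrC IHn /= mulr1 -/(nest _ _ _) -/(mark _ _ _ _).
ring.
Qed.

End ShuffleProduct.

(** * Weights of the generating series and the nested sums of the dual index *)

Section Weights.
Variables (R : realType) (X : R).
Hypotheses (X0 : 0 <= X) (X1 : X < 1).
Local Notation E := (ennreal R).
Local Notation x := (enn X).
Local Notation r := (@recip R).

Definition gfactor (n : nat) : E := enn (1 - X / n%:R)^-1.
Definition qweight (n : nat) : E := r n * gfactor n.
(* [ohno_weight k n] is [1 / (n ^ (k - 1) * (n - X))] for [n > 0]. *)
Definition ohno_weight (k n : nat) : E := r n ^+ k * gfactor n.

Local Notation q := qweight.
Local Notation psi := ohno_weight.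

Lemma ratio_lt1 n : X / n%:R < 1.
Proof.
case: n => [|n]; first by rewrite invr0 mulr0.
by rewrite ltr_pdivrMr ?ltr0n// mul1r (lt_le_trans X1)// ler1n.
Qed.

Lemma gfactorE n : gfactor n = 1 + x * q n.
Proof.
have X2 := ratio_lt1 n; have X3 : 0 < 1 - X / n%:R by rewrite subr_gt0.
rewrite /q /recip /gfactor -!ennM ?invr_ge0 ?mulr_ge0 ?invr_ge0// ?ltW// -enn1 -ennD//.
  congr enn; rewrite mulrA; move: (X / n%:R) X3 => y y1.
  by field; rewrite gt_eqF.
by rewrite !mulr_ge0 ?invr_ge0// ltW.
Qed.

Lemma ohno_weight_series y n :
  tsum (fun i => x ^+ i * power_weight R (y + i) n) = psi y n.
Proof.
rewrite /psi /gfactor -tsum_geometric ?ratio_lt1//; last by rewrite mulr_ge0.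
rewrite -tsumZl; apply: eq_tsum => i.
by rewrite /power_weight exprD ennM// /recip exprMn; ring.
Qed.

Lemma ohno_weightS k n : psi k n = r n ^+ k + x * psi k.+1 n.
Proof. by rewrite /psi {1}gfactorE /q exprS; ring. Qed.

Definition upop (f : nat -> E) (a : nat) : E := tail (fun n => q n * f n) a.

(** For [t > 0] this is the nested sum of ({1}^(t-1), 2): the last component 2 has the weight
    [q n * r n]. *)
Definition upsum (t : nat) : nat -> E := iter t upop r.

(* [upmark (ohno_weight s) t 0] is [G(s,t)]. *)
Fixpoint upmark (v : nat -> E) (t : nat) : nat -> E :=
  if t is t'.+1 then upop (fun n => v n * upsum t' n + upmark v t' n)
  else fun=> 0.

Lemma nest_dual n a : nest psi (rcons (nseq n 1%N) 2) a = upsum n.+1 a.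
Proof.
elim: n a => [|n IH] a; rewrite [rcons _ _]/= nest_cons; apply: eq_tail => m _.
  by rewrite /psi /q /= expr2; ring.
by rewrite IH /psi expr1.
Qed.

Lemma mark_dual v n a : mark v psi (rcons (nseq n 1%N) 2) a = upmark v n.+1 a.
Proof.
elim: n a => [|n IH] a; rewrite [rcons _ _]/= mark_cons; apply: eq_tail => m _.
  by rewrite /psi /q /= expr2; ring.
by rewrite IH /psi expr1 nest_dual.
Qed.

End Weights.

(** * Connected sums *)

Section Operators.
Variables (R : realType) (X : R).
Hypotheses (X0 : 0 <= X) (X1 : X < 1).
Local Notation E := (ennreal R).
Local Notation x := (enn X).
Local Notation r := (@recip R).
Local Notation q := (qweight X).
Local Notation psi := (ohno_weight X).
Local Notation T := (upop X).
Local Notation N := (upsum X).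

Lemma tail_shift (f : nat -> E) a : tail f a = tsum (fun k => f (a + k).+1).
Proof.
rewrite /tail (@tsum_inj R _ _ (fun k => (a + k).+1)).
- by apply: eq_tsum => k; rewrite /= ltnS leq_addr mul1r.
- by move=> k l [] /addnI.
- move=> n nN; case: ltnP => [an|]; last by rewrite mul0r.
  by case: nN; exists (n - a.+1)%N; rewrite -addSn subnKC.
Qed.

Lemma tail_telescope (u : nat -> R) a : (forall n, (a <= n)%N -> u n.+1 <= u n) ->
  u @ \oo --> (0 : R) -> tail (fun n => enn (u n.-1 - u n)) a = enn (u a).
Proof.
move=> ud u0; rewrite tail_shift -[a in RHS]addn0.
rewrite -(@tsum_telescope _ (fun k => u (a + k)%N)).
- by apply: eq_tsum => k; rewrite addnS.
- by move=> k; rewrite addnS ud// leq_addr.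
- rewrite (_ : (fun k => _) = [sequence u (k + a)%N]_k); first by rewrite cvg_shiftn.
  by apply/funext => k; rewrite addnC.
Qed.

Lemma tail_exchange (f g : nat -> E) (K : nat -> nat -> E) a c :
  tail (fun m => f m * tail (fun b => g b * K m b) c) a =
  tail (fun b => g b * tail (fun m => f m * K m b) a) c.
Proof.
transitivity (tail (fun b => tsum (fun m => (a < m)%:R * (f m * (g b * K m b)))) c).
  by rewrite tail_tsum; apply: eq_tsum => m; rewrite -!tailZ.
by apply: eq_tail => b _; rewrite -tailZ; apply: eq_tsum => m; congr (_ * _); ring.
Qed.

Lemma eq_upop (f g : nat -> E) a : (forall n, (a < n)%N -> f n = g n) ->
  T f a = T g a.
Proof. by move=> fg; apply: eq_tail => n /fg ->. Qed.

Lemma upopD (f g : nat -> E) a : T (fun n => f n + g n) a = T f a + T g a.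
Proof. by rewrite /upop -tailD; apply: eq_tail => n _; rewrite mulrDr. Qed.

Lemma upopZ c (f : nat -> E) a : T (fun n => c * f n) a = c * T f a.
Proof. by rewrite /upop -tailZ; apply: eq_tail => n _; rewrite mulrCA. Qed.

Lemma upop_tail (g : nat -> E) (K : nat -> nat -> E) a c :
  T (fun m => tail (fun b => g b * K m b) c) a = tail (fun b => g b * T (K^~ b) a) c.
Proof. by rewrite /upop tail_exchange. Qed.

Lemma eq_iter_upop s (f g : nat -> E) a : (forall n, (a <= n)%N -> f n = g n) ->
  iter s T f a = iter s T g a.
Proof.
elim: s a => [|s IH] a fg /=; first exact: fg.
by apply: eq_upop => n an; apply: IH => m nm; apply/fg/(leq_trans _ nm)/ltnW.
Qed.

Lemma iter_upopD s (f g : nat -> E) a :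
  iter s T (fun n => f n + g n) a = iter s T f a + iter s T g a.
Proof. by elim: s a => [//|s IH] a /=; rewrite -upopD; apply: eq_upop. Qed.

Lemma iter_upopZ s c (f : nat -> E) a :
  iter s T (fun n => c * f n) a = c * iter s T f a.
Proof. by elim: s a => [//|s IH] a /=; rewrite -upopZ; apply: eq_upop. Qed.

Lemma iter_upop_tail s (g : nat -> E) (K : nat -> nat -> E) a c :
  iter s T (fun n => tail (fun b => g b * K n b) c) a =
  tail (fun b => g b * iter s T (K^~ b) a) c.
Proof. by elim: s a => [//|s IH] a /=; rewrite -upop_tail; apply: eq_upop. Qed.

Lemma upmarkD (v w : nat -> E) c t a :
  upmark X (fun n => v n + c * w n) t a = upmark X v t a + c * upmark X w t a.
Proof.
elim: t a => [|t IH] a; first by rewrite mulr0 addr0.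
rewrite /= -upopZ -upopD; apply: eq_upop => n _; rewrite IH; ring.
Qed.

Lemma upmark_ext (v w : nat -> E) t a : (forall n, v n = w n) ->
  upmark X v t a = upmark X w t a.
Proof. by move=> /funext ->. Qed.

Lemma qweightE n : (0 < n)%N -> q n = enn (n%:R - X)^-1.
Proof.
move=> n0; rewrite /qweight /recip /gfactor -ennM ?invr_ge0//; last first.
  by rewrite subr_ge0 ltW// ratio_lt1.
have n0' : 0 < n%:R :> R by rewrite ltr0n.
congr enn; rewrite -invfM; congr (_^-1); field; exact: lt0r_neq0.
Qed.

Lemma natr_gtX n : 0 < n.+1%:R - X.
Proof. by rewrite subr_gt0 (lt_le_trans X1)// ler1n. Qed.

End Operators.

(** * The connector and its transport relations *)

Section Connector.
Variables (R : realType) (X : R).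
Hypotheses (X0 : 0 <= X) (X1 : X < 1).
Local Notation E := (ennreal R).
Local Notation x := (enn X).
Local Notation r := (@recip R).
Local Notation q := (qweight X).
Local Notation psi := (ohno_weight X).
Local Notation T := (upop X).
Local Notation N := (upsum X).

(** Equals Gamma(m+1-X) Gamma(b+1-X) / (Gamma(1-X) Gamma(m+b+1-X)), which explains the symmetry in
    [m] and [b]. *)
Definition connector (m b : nat) : R :=
  \prod_(j < m) ((j.+1%:R - X) / (j.+1%:R + b%:R - X)).

Local Notation C := connector.

Let den_gt0 j b : 0 < j.+1%:R + b%:R - X.
Proof. by rewrite addrAC ltr_pwDl ?natr_gtX. Qed.

Lemma connectorSl m b :
  C m.+1 b = C m b * ((m.+1%:R - X) / (m.+1%:R + b%:R - X)).
Proof. by rewrite /C big_ord_recr. Qed.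

Lemma connectorSr m b :
  C m b.+1 = C m b * ((b.+1%:R - X) / (m%:R + b.+1%:R - X)).
Proof.
elim: m => [|m IH].
  by rewrite /C !big_ord0 mul1r add0r divff// gt_eqF// natr_gtX.
rewrite !connectorSl IH.
have h1 := den_gt0 m b; have h2 := den_gt0 m b.+1.
move: h1 h2; rewrite -![m.+1%:R]natr1 -![b.+1%:R]natr1 => h1 h2.
by field; rewrite !gt_eqF.
Qed.

Lemma connector0l b : C 0 b = 1. Proof. by rewrite /C big_ord0. Qed.

Lemma connectorC m b : C m b = C b m.
Proof.
elim: m b => [|m IH] b.
  rewrite connector0l /C big1// => j _.
  by rewrite addr0 divff// gt_eqF// natr_gtX.
by rewrite connectorSl IH connectorSr [b%:R + _]addrC.
Qed.

Lemma connector_gt0 m b : 0 < C m b.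
Proof. by apply: prodr_gt0 => j _; rewrite divr_gt0// natr_gtX. Qed.

Lemma connectorB m b :
  C m b - C m.+1 b = b%:R * ((m.+1%:R - X)^-1 * C m.+1 b).
Proof.
rewrite connectorSl; have h1 := den_gt0 m b; have h2 := natr_gtX X1 m.
by move: m.+1%:R h1 h2 => y h1 h2; field; rewrite !gt_eqF.
Qed.

Lemma connector_cvg0 b : (0 < b)%N -> C^~ b @ \oo --> (0 : R).
Proof.
case: b => // b _; apply: (@squeeze_cvgr _ _ _ _ (fun=> 0)
    (fun a => b.+1%:R / (1 - X) * harmonic a)).
(* By symmetry C(a,b+1) = C(b,a) (b+1-X) / (b+1+a-X). The first factor is at most 1, and (1-X)(a+1)
   <= b+1+a-X. *)
- apply: nearW => a; rewrite ltW ?connector_gt0//= connectorC connectorSl.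
  have C1 : C b a <= 1.
    apply: prodr_ile1 => j _; apply/andP; split.
      by rewrite divr_ge0// ltW// natr_gtX.
    by rewrite ler_pdivrMr// mul1r lerD2r lerDl.
  have XX : 0 < 1 - X by rewrite subr_gt0.
  apply: (@le_trans _ _ (1 * (b.+1%:R * ((1 - X) * a.+1%:R)^-1))).
    apply: ler_pM => //; [exact/ltW/connector_gt0|exact/ltW/divr_gt0/den_gt0/natr_gtX|].
    apply: ler_pM; [exact/ltW/natr_gtX|by rewrite invr_ge0 ltW| by rewrite gerBl |].
    rewrite lef_pV2 ?posrE ?mulr_gt0//.
    rewrite -[a.+1%:R]natr1 -[b.+1%:R]natr1.
    have : 0 <= X * a%:R by rewrite mulr_ge0.
    have : 0 <= b%:R :> R by [].
    by move: a%:R b%:R => ar br; lra.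
  by rewrite mul1r /= invfM mulrA.
- exact: cvg_cst.
- rewrite -[X in _ --> X](mulr0 (b.+1%:R / (1 - X))); apply: cvgMr.
  exact: cvg_harmonic.
Qed.

Definition conn (m b : nat) : E := enn (connector m b).

Lemma connC m b : conn m b = conn b m.
Proof. by rewrite /conn connectorC. Qed.

(** By [connectorB] each summand is 1/b times a difference of consecutive connectors, so the sum
    telescopes; the connector tends to 0 because [b > 0]. *)
Lemma upop_conn b a : (0 < b)%N -> T (conn^~ b) a = r b * conn a b.
Proof.
move=> b0; rewrite -[conn a b](@tail_telescope _ (C^~ b)); first last.
- exact: connector_cvg0.
- move=> n _; rewrite -subr_ge0 connectorB mulr_ge0// mulr_ge0 ?ltW ?connector_gt0//.
  by rewrite invr_gt0 natr_gtX.
rewrite -tailZ; apply: eq_tail => -[//|n] _ /=.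
rewrite connectorB ennM//; last first.
  by rewrite mulr_ge0 ?ltW ?connector_gt0// invr_gt0 natr_gtX.
rewrite enn_nat mulrA [r b * _]mulrC recipE// mul1r ennM ?qweightE//.
  by rewrite invr_ge0 ltW// natr_gtX.
by rewrite ltW// connector_gt0.
Qed.

Lemma upop_connr m b : (0 < m)%N -> T (conn m) b = r m * conn m b.
Proof.
by move=> m0; rewrite connC -upop_conn//; apply: eq_upop => n _; rewrite connC.
Qed.

Lemma iter_upop_conn s m b : (0 < m)%N ->
  iter s T (conn m) b = r m ^+ s * conn m b.
Proof.
move=> m0; elim: s b => [|s IH] b; first by rewrite mul1r.
rewrite iterS; under eq_upop => n _ do rewrite IH.
by rewrite upopZ upop_connr// mulrA -exprSr.
Qed.

(** Each [T] passes through the connector and becomes a factor 1/b. For [t = a = 0] the left side is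
    the default value [r 0 = 0] while the right side diverges; the hypothesis excludes this. *)
Lemma upsumE t a : (0 < t + a)%N ->
  N t a = tail (fun b => q b * (r b ^+ t * conn a b)) 0.
Proof.
elim: t a => [|t IH] a ta.
  under eq_tail => b _ do rewrite mul1r connC.
  by rewrite -/(T (conn^~ a) 0) upop_conn// /conn connector0l enn1 mulr1.
rewrite /upsum iterS -/(upsum X t).
under eq_upop => m am do rewrite IH ?addn_gt0 ?(leq_ltn_trans _ am) ?orbT//.
rewrite upop_tail; apply: eq_tail => b b0.
by rewrite upopZ upop_conn// exprSr -mulrA.
Qed.

(** The right side is the series of the index (t+1), so this is the equality of the generating
    series of (t+1) and of its dual. *)
Lemma upsum0E t : (0 < t)%N -> N t 0 = tail (fun b => q b * r b ^+ t) 0.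
Proof.
move=> t0; rewrite upsumE ?addn0//; apply: eq_tail => b _.
by rewrite /conn connector0l enn1 mulr1.
Qed.

(* [hweight t b c] is [\sum_(1 <= i <= t) b ^- (t - i) * c ^- i]. *)
Fixpoint hweight (t b c : nat) : E :=
  if t is t'.+1 then r c * (r b ^+ t' + hweight t' b c) else 0.

(** At the marked variable [m], [iter_upop_conn] trades the power m^-s for [s] operators on the side
    of [b], which create the new end [c]. Every further [upop] is absorbed by the connector as a
    factor 1/c, whence the recursion of [hweight]. *)
Lemma upmark_transport s t a : upmark X (fun n => r n ^+ s) t a =
  tail (fun b => q b * iter s T (fun c => hweight t b c * conn a c) b) 0.
Proof.
elim: t a => [|t IH] a /=.
  rewrite /tail tsum0// => b.
  rewrite (@eq_iter_upop _ _ _ _ (fun c => 0 * conn a c))//.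
  by rewrite iter_upopZ mul0r !mulr0.
transitivity (T (fun m => tail (fun b => q b *
    iter s T (fun c => (r b ^+ t + hweight t b c) * conn m c) b) 0) a).
  apply: eq_upop => m am; have m0 := leq_ltn_trans (leq0n a) am.
  rewrite upsumE ?addn_gt0 ?m0 ?orbT// -tailZ IH -tailD; apply: eq_tail => b _.
  have -> : r m ^+ s * (q b * (r b ^+ t * conn m b)) =
      q b * (r b ^+ t * (r m ^+ s * conn m b)) by ring.
  rewrite -iter_upop_conn// -iter_upopZ -mulrDr -iter_upopD; congr (_ * _).
  by apply: eq_iter_upop => c _; rewrite mulrDl.
rewrite upop_tail; apply: eq_tail => b b0; congr (_ * _).
rewrite {1}/upop -iter_upop_tail; apply: eq_iter_upop => c bc.
by rewrite [r c * _]mulrC -mulrA -upop_conn ?(leq_trans b0)// -upopZ.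
Qed.

(** A sum over chains 0 < b_0 < ... < b_s with the weight [q] at every point; [hweight] involves
    only the two ends b_0 and b_s. *)
Definition cyclic_sum s t : E :=
  tail (fun b => q b * iter s T (hweight t b) b) 0.

(** [ohno_weightS] splits the mark into n^-s and X times the mark for s+1. The first part is
    transported at [a = 0], where all connectors are 1. *)
Lemma upmark_cyclic_left s t : upmark X (psi s) t 0 =
  cyclic_sum s t + x * upmark X (psi s.+1) t 0.
Proof.
rewrite (@upmark_ext _ _ _ (fun n => r n ^+ s + x * psi s.+1 n)); last first.
  by move=> n; rewrite ohno_weightS.
rewrite upmarkD upmark_transport; congr (_ + _); apply: eq_tail => b _.
by congr (_ * _); apply: eq_iter_upop => c _; rewrite /conn connector0l enn1 mulr1.
Qed.

(** * Finiteness of the nested sums *)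

Lemma qweight_le n : (ennval (q n) <= ennval (enn (1 - X)^-1 * r n)%R)%E.
Proof.
rewrite /qweight mulrC; apply: enn_leM => //; apply: enn_le.
have XX : 0 < 1 - X by rewrite subr_gt0.
have Xn : X / n%:R <= X.
  case: n => [|n]; first by rewrite invr0 mulr0.
  by rewrite ler_pdivrMr// ler_peMr// ler1n.
by rewrite lef_pV2 ?posrE ?lerB// (lt_le_trans XX)// lerB.
Qed.

Lemma recip_le1 n : (ennval (r n) <= ennval (1%R : E))%E.
Proof.
rewrite -enn1; apply: enn_le; case: n => [|n]; first by rewrite invr0.
by rewrite invf_le1// ler1n.
Qed.

Lemma recip_square_fin : enn_fin (tail (fun n => r n * r n) 0).
Proof.
apply: (@enn_fin_le _ _ (enn 2)); last exact: enn_fin_enn.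
rewrite -[2](_ : 2 * harmonic 0 = _); last by rewrite /= invr1 mulr1.
(* [harmonic n] is 1/(n+1), so the telescoping term is 2/n - 2/(n+1), which is at least 1/n^2 for n
   >= 1. *)
rewrite -(@tail_telescope _ (fun n => 2 * harmonic n)); first last.
- rewrite -[X in _ --> X](mulr0 2); apply: cvgMr; exact: cvg_harmonic.
- by move=> n _; rewrite ler_pM2l// lef_pV2 ?posrE// ler_nat.
apply: le_tsum => -[|n]; first by rewrite !mul0r.
apply: enn_leM => //; rewrite /recip -ennM ?invr_ge0//; apply: enn_le.
rewrite /= -invfM -mulrBr -[n.+2%:R]natr1.
have : 1 <= n.+1%:R :> R by rewrite ler1n.
move: n.+1%:R => a a1.
have a0 : 0 < a by rewrite (lt_le_trans _ a1).
have b0 : 0 < a + 1 by rewrite addr_gt0.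
rewrite -subr_ge0 [leRHS](_ : _ = (a - 1) / (a * a * (a + 1))).
  by rewrite divr_ge0 ?subr_ge0// !mulr_ge0// ltW.
by field; rewrite !gt_eqF.
Qed.

Lemma upsum_fin t : (0 < t)%N -> enn_fin (N t 0).
Proof.
case: t => // t _; rewrite upsum0E//.
apply: (@enn_fin_le _ _ (enn (1 - X)^-1 * tail (fun n => r n * r n) 0)).
  rewrite -tailZ; apply: le_tsum => n; apply: enn_leM => //.
  rewrite mulrA; apply: enn_leM; first exact: qweight_le.
  rewrite -[leRHS]/(ennval (r n)) exprS -[X in (_ <= ennval X)%E]mulr1.
  apply: enn_leM => //; elim: t => [|t IH]; first by rewrite expr0.
  by rewrite exprS -[X in (_ <= ennval X)%E]mulr1; apply: enn_leM => //; apply: recip_le1.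
by rewrite enn_finM ?enn_fin_enn ?recip_square_fin.
Qed.

End Connector.

(** * The cyclic sum formula *)

Section CyclicSum.
Variables (R : realType) (X : R).
Hypotheses (X0 : 0 <= X) (X1 : X < 1).
Local Notation E := (ennreal R).
Local Notation x := (enn X).
Local Notation r := (@recip R).
Local Notation q := (qweight X).
Local Notation psi := (ohno_weight X).
Local Notation T := (upop X).
Local Notation N := (upsum X).

Definition low (f : nat -> E) (c : nat) : E :=
  tsum (fun m => (0 < m < c)%N%:R * f m).

(** The adjoint of [upop] for the pairing [tail (fun b => q b * (u b * f b)) 0]. Its iterates on 1,
    below denoted [e k], are the elementary symmetric sums of [q 1], ..., [q (c - 1)]. *)
Definition lowop (f : nat -> E) : nat -> E := low (fun m => q m * f m).

Local Notation L := lowop.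
Local Notation e k := (iter k L (fun=> 1)).

Lemma eq_low (f g : nat -> E) c : (forall m, (0 < m < c)%N -> f m = g m) ->
  low f c = low g c.
Proof.
move=> fg; apply: eq_tsum => m; case: andP => [[m0 mc]|]; last by rewrite !mul0r.
by rewrite fg// m0.
Qed.

Lemma le_low (f g : nat -> E) c :
  (forall m, (0 < m < c)%N -> (ennval (f m) <= ennval (g m))%E) ->
  (ennval (low f c) <= ennval (low g c))%E.
Proof.
move=> fg; apply: le_tsum => m; case: andP => [[m0 mc]|_]; last by rewrite !mul0r.
by apply: (enn_leM (lexx _)); rewrite fg// m0.
Qed.

Lemma lowD (f g : nat -> E) c : low (fun m => f m + g m) c = low f c + low g c.
Proof. by rewrite /low -tsumD; apply: eq_tsum => m; rewrite mulrDr. Qed.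

Lemma lowZ k (f : nat -> E) c : low (fun m => k * f m) c = k * low f c.
Proof. by rewrite /low -tsumZl; apply: eq_tsum => m; rewrite mulrCA. Qed.

Lemma lowS (f : nat -> E) c : low f c.+1 = low f c + (0 < c)%:R * f c.
Proof.
rewrite -[_ * f c](@tsum_delta R _ c (fun m => (0 < m)%:R * f m)) /low -tsumD.
apply: eq_tsum => m; rewrite ltnS leq_eqVlt.
case: (ltngtP m c) => _; rewrite ?andbF ?andbT /= ?(mul0r, mul1r, addr0, add0r)//.
Qed.

Lemma low0 (f : nat -> E) : low f 0 = 0.
Proof. by rewrite /low tsum0// => m; rewrite ltn0 andbF mul0r. Qed.

Lemma low1 (f : nat -> E) : low f 1 = 0.
Proof. by rewrite lowS low0 mul0r addr0. Qed.

Lemma low_big (f : nat -> E) c : low f c = \sum_(1 <= m < c) f m.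
Proof.
elim: c => [|[|c] IH]; first by rewrite low0 big_nil.
  by rewrite low1 big_nil.
by rewrite lowS IH mul1r [RHS]big_nat_recr.
Qed.

Lemma lowM (f g : nat -> E) c : low f c * low g c =
  low (fun m => f m * low g m) c + low (fun m => g m * low f m) c +
  low (fun m => f m * g m) c.
Proof.
elim: c => [|c IH]; first by rewrite !low0 mul0r !addr0.
rewrite !lowS mulrDl !mulrDr IH; case: (0 < c)%N; rewrite ?(mul1r, mul0r, mulr0, addr0)//.
ring.
Qed.

Lemma eq_iter_lowop s (f g : nat -> E) c : (forall m, (m <= c)%N -> f m = g m) ->
  iter s L f c = iter s L g c.
Proof.
elim: s c => [|s IH] c fg /=; first exact: fg.
apply: eq_low => m /andP[_ mc]; rewrite (IH m)// => n nm.
by apply/fg/(leq_trans nm)/ltnW.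
Qed.

Lemma le_iter_lowop s (f g : nat -> E) c :
  (forall m, (m <= c)%N -> (ennval (f m) <= ennval (g m))%E) ->
  (ennval (iter s L f c) <= ennval (iter s L g c))%E.
Proof.
elim: s c => [|s IH] c fg; first exact: fg.
rewrite !iterS; apply: le_low => m /andP[_ mc]; apply: (enn_leM (lexx _)); apply: IH => n nm.
by apply/fg/(leq_trans nm)/ltnW.
Qed.

Lemma lowopD (f g : nat -> E) c : L (fun m => f m + g m) c = L f c + L g c.
Proof. by rewrite /L -lowD; apply: eq_low => m _; rewrite mulrDr. Qed.

Lemma lowopZ k (f : nat -> E) c : L (fun m => k * f m) c = k * L f c.
Proof. by rewrite /L -lowZ; apply: eq_low => m _; rewrite mulrCA. Qed.

Lemma iter_lowopD s (f g : nat -> E) c :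
  iter s L (fun m => f m + g m) c = iter s L f c + iter s L g c.
Proof.
by elim: s c => [//|s IH] c /=; rewrite -lowopD; apply: eq_low => m _; rewrite IH.
Qed.

Lemma iter_lowopZ s k (f : nat -> E) c :
  iter s L (fun m => k * f m) c = k * iter s L f c.
Proof.
by elim: s c => [//|s IH] c /=; rewrite -lowopZ; apply: eq_low => m _; rewrite IH.
Qed.

Lemma tail_low (f : nat -> E) (G : nat -> nat -> E) :
  tail (fun b => f b * tail (fun m => q m * G b m) b) 0 =
  tail (fun m => q m * low (fun b => f b * G b m) m) 0.
Proof.
transitivity (tsum (fun b => tsum (fun m =>
    (0 < b < m)%N%:R * (f b * (q m * G b m))))).
  apply: eq_tsum => b; rewrite /tail -!tsumZl; apply: eq_tsum => m.
  by case: (0 < b)%N; case: (b < m)%N; rewrite /= ?(mul0r, mulr0, mul1r).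
rewrite tsum_exchange; apply: eq_tsum => m.
rewrite /low -!tsumZl; apply: eq_tsum => b.
case: (ltnP 0 m) => m0.
  by rewrite mul1r; ring.
rewrite (_ : (b < m)%N = false) ?andbF ?mul0r//.
by rewrite ltnNge (leq_trans m0).
Qed.

Lemma upop_lowop_adjoint (u f : nat -> E) :
  tail (fun b => q b * (u b * T f b)) 0 = tail (fun m => q m * (L u m * f m)) 0.
Proof.
transitivity (tail (fun b => (q b * u b) * tail (fun m => q m * f m) b) 0).
  by apply: eq_tail => b _; rewrite mulrA.
rewrite (tail_low _ (fun b m => f m)); apply: eq_tail => m _; congr (_ * _).
by rewrite mulrC -lowZ; apply: eq_low => b _; rewrite mulrC.
Qed.

Lemma iter_upop_low s (K : nat -> nat -> E) a c :
  iter s T (fun n => low (K^~ n) a) c = low (fun b => iter s T (K b) c) a.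
Proof.
elim: s c => [//|s IH] c; rewrite iterS.
under eq_upop => n _ do rewrite IH.
transitivity (tail (fun n => tsum (fun b =>
    (0 < b < a)%N%:R * (q n * iter s T (K b) n))) c).
  by apply: eq_tail => n _; rewrite -tsumZl; apply: eq_tsum => b; rewrite mulrCA.
by rewrite tail_tsum; apply: eq_tsum => b; rewrite tailZ.
Qed.

(* Both sides sum [k b_0 b_s * q b_0 * ... * q b_s] over
   [0 < b_0 < ... < b_s]. *)
Lemma chain_reverse s (k : nat -> nat -> E) :
  tail (fun b => q b * iter s T (k b) b) 0 =
  tail (fun c => q c * iter s L (k^~ c) c) 0.
Proof.
elim: s k => [//|s IH] k.
rewrite (tail_low _ (fun b m => iter s T (k b) m)).
transitivity (tail (fun m => q m * iter s T (fun c => L (k^~ c) m) m) 0).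
  apply: eq_tail => m _; congr (_ * _); rewrite iter_upop_low.
  by apply: eq_low => b _; rewrite -iter_upopZ.
by rewrite IH; apply: eq_tail => c _; rewrite iterSr.
Qed.

(* [chains j s u n a] is [\sum_(k < s) N (s - 1 - k + j) n * L^k u a]. *)
Fixpoint chains (j s : nat) (u : nat -> E) (n a : nat) : E :=
  if s is s'.+1 then N (s' + j) n * u a + L (chains j s' u n) a else 0.

Lemma chainsS j s u n a :
  chains j s.+1 u n a = N (s + j) n * u a + L (chains j s u n) a.
Proof. by []. Qed.

Lemma upmarkS v s :
  upmark X v s.+1 = T (fun n => v n * N s n + upmark X v s n).
Proof. by []. Qed.

Lemma chains_lowop j s u n a : chains j s (L u) n a = L (chains j s u n) a.
Proof.
elim: s a => [|s IH] a.
  rewrite [RHS](_ : _ = L (fun m => 0 * 1) a); first by rewrite lowopZ mul0r.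
  by apply: eq_low => m _; rewrite mul0r.
rewrite !chainsS [RHS]lowopD lowopZ; congr (_ + _); apply: eq_low => m _.
by rewrite IH.
Qed.

(** Adjointness moves the operators outside the marked variable [n] onto [u]. The chain above [n]
    remains as [upsum], the chain below becomes a power of [L], and [chains] sums over the position
    of [n]. *)
Lemma upmark_pairing v s u :
  tail (fun m => q m * (u m * upmark X v s m)) 0 =
  tail (fun n => q n * (v n * chains 0 s (L u) n n)) 0.
Proof.
elim: s u => [|s IH] u.
  by apply: eq_tail => m _; rewrite /= !mulr0.
rewrite upmarkS upop_lowop_adjoint.
transitivity (tail (fun n => q n * (v n * (N s n * L u n))) 0 +
    tail (fun n => q n * (L u n * upmark X v s n)) 0).
  by rewrite -tailD; apply: eq_tail => n _; ring.
rewrite IH -tailD; apply: eq_tail => n _.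
by rewrite chainsS addn0 chains_lowop; ring.
Qed.

Lemma upmark_chains v s : upmark X v s.+1 0 =
  tail (fun n => q n * (v n * chains 0 s.+1 (fun=> 1) n n)) 0.
Proof.
rewrite upmarkS; transitivity (tail (fun n => q n * (v n * N s n)) 0 +
    tail (fun n => q n * (1 * upmark X v s n)) 0).
  by rewrite -tailD; apply: eq_tail => n _; ring.
rewrite upmark_pairing -tailD; apply: eq_tail => n _.
by rewrite chainsS addn0 chains_lowop; ring.
Qed.

(** Both sums consist of terms [N (s - k) n] times [e k a]; only k = s, where [N 0] is [r], is
    missing from [chains 1]. *)
Lemma chains_shift s n a :
  chains 0 s.+1 (fun=> 1) n a = chains 1 s (fun=> 1) n a + r n * e s a.
Proof.
elim: s a => [|s IH] a.
  rewrite chainsS add0r [L _ a](_ : _ = L (fun m => 0 * 1) a); last first.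
    by apply: eq_low => m _; rewrite mul0r.
  by rewrite lowopZ mul0r addr0.
rewrite !chainsS iterS -lowopZ -addrA -lowopD addn0 addn1.
by congr (_ + _); apply: eq_low => m _; rewrite IH.
Qed.

(** * Partial fractions with differences of summation variables *)

Definition dist (n a : nat) : E := enn (n%:R - a%:R)^-1.

(** Induction on [a]: raising [a] by one adds a telescoping series with value 1/(n-a). The summand
    [r n] is the term at 0, which [low] omits. *)
Lemma dist_telescope a n : (0 < a)%N -> (a <= n)%N ->
  tail (fun m => enn ((m%:R - a%:R)^-1 - m%:R^-1)) n = low (dist n) a + r n.
Proof.
have cvgd b : (fun m : nat => (m%:R - b%:R)^-1 : R) @ \oo --> (0 : R).
  rewrite -(cvg_shiftn b.+1); rewrite (_ : (fun _ => _) = harmonic).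
    exact: cvg_harmonic.
  by apply/funext => m; rewrite /harmonic /= -addSnnS natrD addrK.
have decd b m : (b < m)%N -> (m.+1%:R - b%:R)^-1 <= (m%:R - b%:R)^-1 :> R.
  move=> bm; rewrite lef_pV2 ?posrE ?subr_gt0 ?ltr_nat ?(leqW bm)//.
  by rewrite lerB// ler_nat.
case: a => // a _; elim: a => [|a IH] an.
  rewrite low1 add0r -[r n](@tail_telescope _ (fun m => m%:R^-1)).
  - by apply: eq_tail => -[//|m] _; rewrite /= -natrB// subn1.
  - by move=> m nm; have := decd 0%N m (leq_trans an nm); rewrite !subr0.
  - by have := cvgd 0%N; under eq_fun do rewrite subr0.
rewrite lowS mul1r addrAC -IH 1?ltnW//.
rewrite -[dist _ _](@tail_telescope _ (fun m => (m%:R - a.+1%:R)^-1)); first last.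
- exact: cvgd.
- by move=> m nm; apply: decd; apply: leq_trans nm.
rewrite -tailD; apply: eq_tail => -[//|m]; rewrite ltnS => nm /=.
have am := leq_trans an nm.
have e : m.+1%:R - a.+2%:R = m%:R - a.+1%:R :> R.
  by rewrite -[m.+1%:R]natr1 -[a.+2%:R]natr1; ring.
rewrite -ennD.
- by rewrite e; congr enn; ring.
- rewrite subr_ge0 lef_pV2 ?posrE ?subr_gt0 ?ltr_nat ?ltr0n//; first by rewrite gerBl.
  exact: ltnW.
- by rewrite subr_ge0 decd.
Qed.

(** Termwise, 1/((m-X)(m-a)) + X/((a-X)(m-X)m) = (1/(m-a) - 1/m)/(a-X); the sum over m > n is
    [dist_telescope]. *)
Lemma dist_step a n : (0 < a)%N -> (a <= n)%N ->
  T (dist^~ a) n + x * (q a * T r n) = q a * (low (dist n) a + r n).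
Proof.
move=> a0 an; rewrite -dist_telescope// -!tailZ -tailD; apply: eq_tail => m nm.
have m0 : (0 < m)%N := leq_ltn_trans (leq0n n) nm.
have am : (a < m)%N := leq_ltn_trans an nm.
have aX : 0 < a%:R - X by case: a a0 {an am} => // a _; rewrite natr_gtX.
have mX : 0 < m%:R - X by case: m m0 {nm am} => // m _; rewrite natr_gtX.
have ma : 0 < m%:R - a%:R :> R by rewrite subr_gt0 ltr_nat.
have m0' : 0 < m%:R :> R by rewrite ltr0n.
rewrite !qweightE// /dist /recip -!ennM ?invr_ge0 ?mulr_ge0 ?invr_ge0 ?(ltW aX)
  ?(ltW mX) ?(ltW ma)//; last first.
  by rewrite subr_ge0 lef_pV2 ?posrE// gerBl.
rewrite -ennD ?mulr_ge0 ?invr_ge0 ?(ltW aX) ?(ltW mX) ?(ltW ma)//.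
congr enn; move: m%:R a%:R aX mX ma m0' => m' a' *.
by field; rewrite !gt_eqF.
Qed.

Definition distsum p n a : E := iter p T (dist^~ a) n.

Lemma distsum_step p n a : (0 < a)%N -> (a <= n)%N ->
  distsum p.+1 n a + x * (q a * N p.+1 n) = q a * (low (distsum p n) a + N p n).
Proof.
move=> a0 an; rewrite /distsum /upsum !iterSr.
rewrite mulrA -iter_upopZ -iter_upopD.
rewrite (@eq_iter_upop _ _ _ _ (fun c => q a * (low (dist c) a + r c))); last first.
  by move=> c nc; rewrite -mulrA dist_step// (leq_trans an).
by rewrite iter_upopZ iter_upopD (iter_upop_low _ (fun b c => dist c b)).
Qed.

(** Each use of [distsum_step] trades one upper sum in [n] for one lower sum in [a], until only
    [dist] is left; the byproducts collect in [chains]. *)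
Lemma distsum_unroll s n a : (0 < a)%N -> (a <= n)%N ->
  distsum s.+1 n a + x * (q a * chains 1 s.+1 (fun=> 1) n a) =
  q a * (iter s L (low (dist n)) a + chains 0 s.+1 (fun=> 1) n a).
Proof.
have Lzero j c : L (chains j 0 (fun=> 1) n) c = 0.
  rewrite (_ : L _ c = L (fun m => 0 * 1) c); first by rewrite lowopZ mul0r.
  by apply: eq_low => m _; rewrite mul0r.
elim: s a => [|s IH] a a0 an.
  by rewrite !chainsS !Lzero !mulr1 !addr0 distsum_step.
rewrite [chains 1 _ _ _ _]chainsS [chains 0 _ _ _ _]chainsS !mulr1 addn0 addn1.
transitivity (q a * (low (distsum s.+1 n) a + N s.+1 n) +
    q a * (x * L (chains 1 s.+1 (fun=> 1) n) a)).
  by rewrite -distsum_step//; ring.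
rewrite -mulrDr addrAC (_ : low _ a + _ = L (iter s L (low (dist n))) a +
  L (chains 0 s.+1 (fun=> 1) n) a); first by rewrite iterS; ring.
rewrite -lowopZ -lowopD /L -lowD; apply: eq_low => m /andP[m0 ma].
rewrite -IH ?(ltnW (leq_trans ma an))//; ring.
Qed.

(** The closed form b (b^-t - c^-t) / (c - b) of a geometric sum, written without subtraction. *)
Lemma hweight_dist t b c : (0 < b)%N -> (b < c)%N ->
  hweight R t b c + b%:R * (r c ^+ t * dist c b) = b%:R * r b ^+ t * dist c b.
Proof.
move=> b0 bc; have c0 := ltn_trans b0 bc.
elim: t => [|t IH]; first by rewrite add0r !expr0 !(mul1r, mulr1).
have cb : c%:R * dist c b = 1 + b%:R * dist c b.
  have bc' : 0 < c%:R - b%:R :> R by rewrite subr_gt0 ltr_nat.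
  rewrite /dist -!enn_nat -!ennM ?invr_ge0 ?(ltW bc')// -enn1 -ennD//.
    by congr enn; move: c%:R b%:R bc' => c' b' *; field; rewrite gt_eqF.
  by rewrite mulr_ge0// invr_ge0 ltW.
have -> : hweight R t.+1 b c + b%:R * (r c ^+ t.+1 * dist c b) =
    r c * (r b ^+ t + (hweight R t b c + b%:R * (r c ^+ t * dist c b))).
  by rewrite /= exprS; ring.
rewrite IH (_ : _ + _ = r b ^+ t * (c%:R * dist c b)); last by rewrite cb; ring.
have -> : r c * (r b ^+ t * (c%:R * dist c b)) = (c%:R * r c) * (r b ^+ t * dist c b).
  by ring.
rewrite recipE// exprS.
have -> : b%:R * (r b * r b ^+ t) * dist c b = (b%:R * r b) * (r b ^+ t * dist c b).
  by ring.
by rewrite recipE.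
Qed.

(** From b/(b-X) - c/(c-X) = X(c-b)/((b-X)(c-X)), divided by c - b. *)
Lemma qweight_dist b c : (0 < b)%N -> (b < c)%N ->
  q b * (b%:R * dist c b) = q c * c%:R * dist c b + x * q c * q b.
Proof.
move=> b0 bc; have c0 := ltn_trans b0 bc.
have bc' : 0 < c%:R - b%:R :> R by rewrite subr_gt0 ltr_nat.
have bX : 0 < b%:R - X by case: b b0 {bc bc'} => // b _; rewrite natr_gtX.
have cX : 0 < c%:R - X by case: c c0 {bc bc'} => // c _; rewrite natr_gtX.
rewrite !qweightE// /dist -!enn_nat -!ennM ?mulr_ge0 ?invr_ge0 ?(ltW bX) ?(ltW cX)
  ?(ltW bc')//.
rewrite -ennD ?mulr_ge0 ?invr_ge0 ?(ltW bX) ?(ltW cX) ?(ltW bc')//.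
congr enn; move: c%:R b%:R bc' bX cX => c' b' *.
by field; rewrite !gt_eqF.
Qed.

Lemma ohno_weightE t n : (0 < n)%N -> q n * (n%:R * r n ^+ t) = psi t n.
Proof.
move=> n0; rewrite /psi /qweight.
have -> : r n * gfactor X n * (n%:R * r n ^+ t) =
    (n%:R * r n) * (r n ^+ t * gfactor X n) by ring.
by rewrite recipE// mul1r.
Qed.

Definition lower_part s t : E :=
  tail (fun n => q n * (psi t n * iter s L (low (dist n)) n)) 0.

Definition top_part s t : E :=
  tail (fun n => q n * (psi t n * (r n * e s n))) 0.

(** Reversing the chain makes its top [c] the outer variable. Then [qweight_dist] moves the weight
    of the lowest variable [b] to [c], at the cost of a term with the factor X. *)
Lemma top_weight_chains s t :
  tail (fun b => q b * iter s.+1 T (fun c => b%:R * (r c ^+ t * dist c b)) b) 0 =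
  lower_part s t + x * top_part s.+1 t.
Proof.
rewrite (chain_reverse _ (fun b c => b%:R * (r c ^+ t * dist c b))).
rewrite -tailZ -tailD; apply: eq_tail => c c0.
rewrite iterSr.
rewrite (@eq_iter_lowop _ _ (fun m => r c ^+ t * q c * c%:R * low (dist c) m +
    x * (r c ^+ t * q c) * L (fun=> 1) m)); last first.
  move=> m mc; rewrite -lowopZ /L -lowZ -lowD; apply: eq_low => b /andP[b0 bm].
  have -> : q b * (b%:R * (r c ^+ t * dist c b)) =
      r c ^+ t * (q b * (b%:R * dist c b)) by ring.
  by rewrite qweight_dist ?(leq_trans bm)//; ring.
rewrite iter_lowopD (iter_lowopZ s (r c ^+ t * q c * c%:R)).
rewrite (iter_lowopZ s (x * (r c ^+ t * q c))) -(iterSr s L) -ohno_weightE//.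
have -> : q c * (q c * (c%:R * r c ^+ t) * (r c * e s.+1 c)) =
    (c%:R * r c) * (q c * (q c * (r c ^+ t) * e s.+1 c)) by ring.
by rewrite recipE// mul1r; ring.
Qed.

Lemma cyclic_sum_top s t :
  cyclic_sum X s.+1 t +
  tail (fun b => q b * iter s.+1 T (fun c => b%:R * (r c ^+ t * dist c b)) b) 0 =
  tail (fun b => q b * (b%:R * r b ^+ t * distsum s.+1 b b)) 0.
Proof.
rewrite -tailD; apply: eq_tail => b b0; rewrite -mulrDr -iter_upopD.
congr (_ * _); rewrite -iter_upopZ !iterS; apply: eq_upop => m bm.
by apply: eq_iter_upop => c mc; rewrite hweight_dist// (leq_trans bm).
Qed.

(** [distsum_unroll] with both arguments equal to [b] turns the first sum into [chains], which
    [upmark_chains] reads as marked sums. The extra summand in [chains_shift] gives [top_part]. *)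
Lemma upmark_cyclic_top s t :
  tail (fun b => q b * (b%:R * r b ^+ t * distsum s.+1 b b)) 0 +
    x * upmark X (psi t) s.+2 0 =
  lower_part s t + x * top_part s.+1 t + upmark X (psi t) s.+1 0.
Proof.
rewrite upmark_chains.
transitivity (tail (fun b => q b * (b%:R * r b ^+ t) *
    (distsum s.+1 b b + x * (q b * chains 1 s.+1 (fun=> 1) b b))) 0 +
  x * top_part s.+1 t).
  rewrite -!tailZ -!tailD; apply: eq_tail => b b0; rewrite chains_shift -ohno_weightE//; ring.
rewrite addrAC; congr (_ + _); rewrite upmark_chains -tailD; apply: eq_tail => b b0.
by rewrite distsum_unroll// ohno_weightE//; ring.
Qed.

(** The variable of [e 1] is either new, in one of k+1 positions, or meets one of the k points of
    the chain, where [q] is at most 1/(1-X). This serves to bound [lower_part]. *)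
Lemma chain_product_le k c : (ennval (e 1 c * e k c)%R <=
  ennval (k.+1%:R * e k.+1 c + k%:R * enn (1 - X)^-1 * e k c)%R)%E.
Proof.
set K := enn _.
have qK m : (ennval (q m) <= ennval K)%E.
  apply: le_trans (qweight_le X0 X1 m) _; rewrite -[leRHS](congr1 (@ennval R) (mulr1 K)).
  by apply: (enn_leM (lexx _)); apply: recip_le1.
elim: k c => [|k IH] c; first by rewrite !mul0r addr0 mul1r mulr1.
have -> : e 1 c * e k.+1 c = e k.+2 c + L (fun m => e 1 m * e k m) c + L (fun m => q m * e k m) c.
  rewrite [e 1 c]/= [e k.+1 c]/= /L lowM; congr (_ + _ + _).
  - by apply: eq_low => m _; rewrite mulr1.
  - by apply: eq_low => m _; rewrite -mulrA; congr (_ * _); rewrite mulrC.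
  - by apply: eq_low => m _; rewrite mulr1.
apply: (@le_trans _ _ (ennval (e k.+2 c +
    L (fun m => k.+1%:R * e k.+1 m + k%:R * K * e k m) c + L (fun m => K * e k m) c))).
  apply: enn_leD; first apply: enn_leD => //.
    by apply: le_low => m _; apply: enn_leM.
  by apply: le_low => m _; apply: (enn_leM (lexx _)); apply: enn_leM.
rewrite lowopD !lowopZ -[X in (_ <= ennval X)%E](_ :
  e k.+2 c + (k.+1%:R * L (e k.+1) c + k%:R * K * L (e k) c) + K * L (e k) c = _)//.
by rewrite [e k.+2 c]/= [e k.+1 c]/= -[k.+2%:R]natr1 -[k.+1%:R in RHS]natr1 -[k.+1%:R in LHS]natr1; ring.
Qed.

Lemma chain_fin k : enn_fin (tail (fun n => q n * (r n * e k n)) 0).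
Proof.
suff -> : tail (fun n => q n * (r n * e k n)) 0 = N k.+1 0 by exact: upsum_fin.
rewrite /upsum iterS.
transitivity (tail (fun n => q n * (1 * iter k T r n)) 0); last first.
  by apply: eq_tail => n _; rewrite mul1r.
(* Adjointness moves all [k] operators onto [u]; u = 1 yields [e k]. *)
have H u : tail (fun n => q n * (u n * iter k T r n)) 0 =
    tail (fun n => q n * (iter k L u n * r n)) 0.
  elim: k u => [//|k IH] u; rewrite iterS upop_lowop_adjoint IH.
  by apply: eq_tail => n _; rewrite iterSr.
by rewrite H; apply: eq_tail => n _; rewrite [r n * _]mulrC.
Qed.

Lemma ohno_weight_le t n : (0 < t)%N ->
  (ennval (psi t n) <= ennval (enn (1 - X)^-1 * r n)%R)%E.
Proof.
case: t => // t _; apply: le_trans (qweight_le X0 X1 n).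
rewrite /psi exprS -mulrA mulrCA -[leRHS](congr1 (@ennval R) (mul1r (q n))).
apply: (fun h => enn_leM h (lexx _)); elim: t => [|t IH]; first by rewrite expr0.
rewrite exprS -[leRHS](congr1 (@ennval R) (mulr1 1)).
by apply: (fun h => enn_leM h IH); apply: recip_le1.
Qed.

Lemma top_part_fin s t : (0 < t)%N -> enn_fin (top_part s t).
Proof.
move=> t0; apply: (@enn_fin_le _ _ (enn (1 - X)^-1 * tail (fun n => q n * (r n * e s n)) 0)).
  rewrite -tailZ; apply: le_tsum => n; apply: (enn_leM (lexx _)).
  rewrite mulrCA; apply: (fun h => enn_leM h (lexx _)).
  apply: le_trans (ohno_weight_le n t0) _.
  rewrite -[leRHS](congr1 (@ennval R) (mulr1 _)).
  by apply: (enn_leM (lexx _)); apply: recip_le1.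
by rewrite enn_finM ?enn_fin_enn ?chain_fin.
Qed.

Lemma low_dist_le n m : (m <= n)%N -> (ennval (low (dist n) m) <= ennval (e 1 n))%E.
Proof.
move=> mn; apply: (@le_trans _ _ (ennval (low (dist n) n))).
  apply: le_tsum => b; apply: (fun h => enn_leM h (lexx _)).
  case: (ltnP b m) => bm; first by rewrite (leq_trans bm).
  by rewrite andbF; case: (_ && _) => //=; rewrite lee01.
(* Replacing b by n - b turns the sum of 1/(n-b) into that of 1/b, and 1/b <= [q b]. *)
rewrite (_ : low (dist n) n = low r n).
  apply: le_low => b _; rewrite mulr1 /qweight -[leLHS](congr1 (@ennval R) (mulr1 _)).
  apply: (enn_leM (lexx _)); rewrite gfactorE// -[leLHS](congr1 (@ennval R) (addr0 _)).
  by apply: enn_leD => //; apply: ennval_ge0.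
rewrite !low_big big_nat_rev /=; apply: eq_big_nat => i /andP[i0 ni].
rewrite /dist /recip add1n subSS natrB 1?ltnW//; congr (enn (_^-1)).
by rewrite opprB addrCA subrr addr0.
Qed.

Lemma lower_part_fin s t : (0 < t)%N -> enn_fin (lower_part s t).
Proof.
move=> t0; set K := enn (1 - X)^-1.
apply: (@enn_fin_le _ _ (K * (s.+1%:R * tail (fun n => q n * (r n * e s.+1 n)) 0 +
    s%:R * K * tail (fun n => q n * (r n * e s n)) 0))); last first.
  have natf k : enn_fin (k%:R : E) by rewrite -enn_nat enn_fin_enn.
  by rewrite enn_finM ?enn_finD ?enn_fin_enn// !enn_finM ?natf ?enn_fin_enn ?chain_fin.
rewrite -!tailZ -tailD -tailZ; apply: le_tsum => n; apply: (enn_leM (lexx _)).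
have -> : K * (s.+1%:R * (q n * (r n * e s.+1 n)) + s%:R * K * (q n * (r n * e s n))) =
    q n * ((K * r n) * (s.+1%:R * e s.+1 n + s%:R * K * e s n)) by ring.
apply: (enn_leM (lexx _)); apply: enn_leM; first exact: ohno_weight_le.
apply: le_trans (chain_product_le s n).
rewrite -iter_lowopZ; apply: le_iter_lowop => m mn; rewrite mulr1.
exact: low_dist_le.
Qed.

(** The weighted sums over chains agree in the three preceding identities and drop out; [lower_part]
    and [top_part] occur on both sides and cancel because they are finite. *)
Lemma upmark_cyclic_right s t : (0 < s)%N -> (0 < t)%N ->
  upmark X (psi t) s 0 = cyclic_sum X s t + x * upmark X (psi t) s.+1 0.
Proof.
case: s => // s _ t0.
apply: (@enn_addIr _ (lower_part s t + x * top_part s.+1 t)).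
  by rewrite enn_finD lower_part_fin// enn_finM ?enn_fin_enn ?top_part_fin.
rewrite [LHS]addrC -upmark_cyclic_top -cyclic_sum_top top_weight_chains.
by rewrite addrAC.
Qed.

End CyclicSum.

(** * Conclusion *)

Section ShuffleRelation.
Variables (R : realType) (X : R).
Hypotheses (X0 : 0 <= X) (X1 : X < 1).
Local Notation E := (ennreal R).
Local Notation x := (enn X).
Local Notation psi := (ohno_weight X).
Local Notation Z := (nest psi).

Definition shuffle_sum s k : E := \sum_(l <- shuffle [:: s] k) Z l 0.

Lemma nest_single t : (0 < t)%N -> Z [:: t.+1] 0 = upsum X t 0.
Proof.
move=> t0; rewrite upsum0E//; apply: eq_tail => n _.
by rewrite /= mulr1 /ohno_weight /qweight exprS; ring.
Qed.

(** Two expansions of one product: the sum of (s) times the sum of (t+1), and the same with (t+1)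
    replaced by its dual, whose sum is equal. *)
Lemma shuffle_relation s t : (0 < t)%N ->
  shuffle_sum s [:: t.+1] + tail (fun n => psi t.+1 n * psi s n) 0 =
  shuffle_sum s (dual [:: t.+1]) + upmark X (psi s) t 0.
Proof.
case: t => // t t0; rewrite dual_single// [_.-1]/= -mark_dual -!nest_shuffle nest_dual.
rewrite -nest_single// nest_shuffle; congr (_ + _).
by rewrite mark_cons; apply: eq_tail => n _; rewrite /= mulr1 addr0.
Qed.

Lemma shuffle_product_fin s t : (1 < s)%N -> (0 < t)%N ->
  [&& enn_fin (shuffle_sum s [:: t.+1]),
      enn_fin (tail (fun n => psi t.+1 n * psi s n) 0),
      enn_fin (shuffle_sum s (dual [:: t.+1])) &
      enn_fin (upmark X (psi s) t 0)].
Proof.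
case: s => [|[|s]]// _ t0.
have : enn_fin (Z [:: s.+2] 0 * Z [:: t.+1] 0).
  by rewrite !nest_single// enn_finM// upsum_fin.
rewrite nest_shuffle -/(shuffle_sum _ _) (_ : mark _ _ _ _ =
  tail (fun n => psi t.+1 n * psi s.+2 n) 0); last first.
  by rewrite mark_cons; apply: eq_tail => n _; rewrite /= mulr1 addr0.
move=> /[dup]; rewrite {2}shuffle_relation// !enn_finD.
by move=> /andP[-> ->] /andP[-> ->].
Qed.

(** This is G(s,t) - G(t,s) = X (G(s+1,t) - G(t,s+1)) with G expressed by [shuffle_relation] and all
    negative terms moved across. *)
Lemma shuffle_sum_cyclic s t : (1 < s)%N -> (1 < t)%N ->
  shuffle_sum s [:: t.+1] + shuffle_sum t (dual [:: s.+1]) +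
    x * (shuffle_sum s.+1 (dual [:: t.+1]) + shuffle_sum t [:: s.+2]) =
  shuffle_sum t [:: s.+1] + shuffle_sum s (dual [:: t.+1]) +
    x * (shuffle_sum s.+1 [:: t.+1] + shuffle_sum t (dual [:: s.+2])).
Proof.
move=> s1 t1; have s0 := ltnW s1; have t0 := ltnW t1.
have fin_real (z : E) : enn_fin z -> exists2 a : R, 0 <= a & z = enn a.
  by move=> zf; exists (fine z); rewrite ?enn_fineK// fine_ge0 ?ennval_ge0.
(* The product depends only on the sum of the two exponents, so the diagonal terms of both shuffle
   relations coincide and cancel. *)
have diag a b : tail (fun n => psi a.+1 n * psi b n) 0 = tail (fun n => psi b.+1 n * psi a n) 0.
  by apply: eq_tail => n _; rewrite /ohno_weight !exprS; ring.
have e1 := upmark_cyclic_left X0 X1 s t.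
have e2 := upmark_cyclic_right X0 X1 s0 t0.
have cfin : enn_fin (cyclic_sum X s t).
  have /and4P[_ _ _] := shuffle_product_fin s1 t0.
  by rewrite e1 enn_finD => /andP[].
have r1 := shuffle_relation s t0; have r2 := shuffle_relation t s0.
have r3 := shuffle_relation s.+1 t0.
have r4 := shuffle_relation t (ltn0Sn s).
have /and4P[f1a f1p f1b f1g] := shuffle_product_fin s1 t0.
have /and4P[f2a f2p f2b f2g] := shuffle_product_fin t1 s0.
have /and4P[f3a f3p f3b f3g] := shuffle_product_fin (ltnW s1 : 1 < s.+1)%N t0.
have /and4P[f4a f4p f4b f4g] := shuffle_product_fin t1 (ltn0Sn s).
rewrite (diag s t) in r2; rewrite (diag s.+1 t) in r4.
case/fin_real: cfin e1 e2 => c c0 ->.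
case/fin_real: f1g r1 => g1 g10 ->; case/fin_real: f2g r2 => g2 g20 ->.
case/fin_real: f3g r3 => g3 g30 ->; case/fin_real: f4g r4 => g4 g40 ->.
case/fin_real: f1p => p p0 ->; case/fin_real: f3p => p' p'0 ->.
case/fin_real: f1a => a1 a10 ->; case/fin_real: f2a => a2 a20 ->.
case/fin_real: f3a => a3 a30 ->; case/fin_real: f4a => a4 a40 ->.
case/fin_real: f1b => b1 b10 ->; case/fin_real: f2b => b2 b20 ->.
case/fin_real: f3b => b3 b30 ->; case/fin_real: f4b => b4 b40 ->.
rewrite -!(ennD, ennM) ?addr_ge0 ?mulr_ge0 ?addr_ge0//.
move=> /enn_inj r4 /enn_inj r3 /enn_inj r2 /enn_inj r1 /enn_inj e1 /enn_inj e2.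
have g4E : g4 = a4 + p' - b4 by have := r4 ltac:(by rewrite addr_ge0) ltac:(by rewrite addr_ge0); lra.
have g3E : g3 = a3 + p' - b3 by have := r3 ltac:(by rewrite addr_ge0) ltac:(by rewrite addr_ge0); lra.
have {}r1 := r1 ltac:(by rewrite addr_ge0) ltac:(by rewrite addr_ge0).
have {}r2 := r2 ltac:(by rewrite addr_ge0) ltac:(by rewrite addr_ge0).
have {}e1 := e1 g10 ltac:(by rewrite addr_ge0// mulr_ge0).
have {}e2 := e2 g20 ltac:(by rewrite addr_ge0// mulr_ge0).
(* [g3] and [g4] are multiplied by X here; after their substitution everything is linear in the
   products with X. *)
congr enn; rewrite g3E in e1; rewrite g4E in e2; lra.
Qed.

End ShuffleRelation.

(** * Comparison of coefficients *)

Section Conclusion.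
Variable R : realType.

Lemma ohno_linE u m : ohno_lin R u m = \sum_(k <- u) ohno_sum R m k.
Proof.
rewrite /ohno_lin; elim: u => [|k u IH]; first by rewrite !big_nil.
by rewrite !big_cons -IH.
Qed.

Lemma ohno_lin_ge0 u m : 0 <= ohno_lin R u m.
Proof. by rewrite ohno_linE sumr_ge0// => k _; apply: ohno_sum_ge0. Qed.

Lemma ohno_lin_generating (X : R) s k : 0 < X -> X < 1 ->
  enn_fin (shuffle_sum X s k) ->
  tsum (fun m => enn X ^+ m * enn (ohno_lin R (shuffle [:: s] k) m)) =
  shuffle_sum X s k.
Proof.
move=> X0 X1; rewrite /shuffle_sum; move: (shuffle _ _) => u fin.
transitivity (\sum_(l <- u) tsum (fun m => enn X ^+ m * enn (ohno_sum R m l))).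
  rewrite -tsum_sum; apply: eq_tsum => m.
  by rewrite ohno_linE enn_sum ?mulr_sumr// => l _; apply: ohno_sum_ge0.
elim: u fin => [|l u IH]; first by rewrite !big_nil.
rewrite !big_cons enn_finD => /andP[lfin /IH ->]; congr (_ + _).
have E : nest (ohno_weight X) l 0 =
    nest (fun y n => tsum (fun i => enn X ^+ i * power_weight R (y + i) n)) l 0.
  by apply: eq_nest => y n _; rewrite ohno_weight_series// ltW.
by rewrite E in lfin *; rewrite ohno_generating.
Qed.

Definition ohno_defect s t m : R :=
  ohno_lin R (shuffle [:: s] [:: t.+1]) m -
  ohno_lin R (shuffle [:: s] (dual [:: t.+1])) m -
  (ohno_lin R (shuffle [:: t] [:: s.+1]) m -
   ohno_lin R (shuffle [:: t] (dual [:: s.+1])) m).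

(** The coefficients of D(s,t) = X D(s+1,t), where D(s,t) = F(s;(t+1)) - F(t;(s+1));
    [shuffle_sum_cyclic] gives this relation for every 0 < X < 1. *)
Lemma ohno_defect_rec s t : (1 < s)%N -> (1 < t)%N ->
  ohno_defect s t 0 = 0 /\
  forall m, ohno_defect s t m.+1 = ohno_defect s.+1 t m.
Proof.
move=> s1 t1; have s0 := ltnW s1; have t0 := ltnW t1.
pose a k l m := ohno_lin R (shuffle [:: k] [:: l.+1]) m.
pose b k l m := ohno_lin R (shuffle [:: k] (dual [:: l.+1])) m.
(* The coefficients of f + g + X (f' + g'). Distributing the terms over two such combinations keeps
   every coefficient nonnegative, as [power_series_unique] requires. *)
pose comb (f g f' g' : nat -> R) m :=
  f m + g m + (if m is m'.+1 then f' m' + g' m' else 0).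
have comb_ge0 f g f' g' m : (forall n, 0 <= f n) -> (forall n, 0 <= g n) ->
    (forall n, 0 <= f' n) -> (forall n, 0 <= g' n) -> 0 <= comb f g f' g' m.
  by move=> *; rewrite /comb !addr_ge0//; case: m => // m; rewrite addr_ge0.
have a0 k l m : 0 <= a k l m by apply: ohno_lin_ge0.
have b0 k l m : 0 <= b k l m by apply: ohno_lin_ge0.
have comb_gen (X : R) f g f' g' : 0 < X -> (forall n, 0 <= f n) -> (forall n, 0 <= g n) ->
    (forall n, 0 <= f' n) -> (forall n, 0 <= g' n) ->
    tsum (fun m => enn X ^+ m * enn (comb f g f' g' m)) =
    tsum (fun m => enn X ^+ m * enn (f m)) + tsum (fun m => enn X ^+ m * enn (g m)) +
    enn X * (tsum (fun m => enn X ^+ m * enn (f' m)) +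
             tsum (fun m => enn X ^+ m * enn (g' m))).
  move=> X0 f0 g0 f'0 g'0; rewrite -!tsumD -tsumZl.
  transitivity (tsum (fun m => enn X ^+ m * enn (f m) + enn X ^+ m * enn (g m)) +
    tsum (fun m => enn X ^+ m * (if m is m'.+1 then enn (f' m') + enn (g' m') else 0))).
    rewrite -tsumD; apply: eq_tsum => m; rewrite /comb.
    case: m => [|m]; first by rewrite addr0 ennD// mulr0 addr0 mulrDr.
    by rewrite !ennD ?addr_ge0//; ring.
  rewrite [X in _ + X = _]tsum_recl mulr0 add0r; congr (_ + _).
  by apply: eq_tsum => m; rewrite exprS; ring.
have eq_comb : comb (a s t) (b t s) (b s.+1 t) (a t s.+1) =1
               comb (a t s) (b s t) (a s.+1 t) (b t s.+1).
  apply: power_series_unique => [n|n|X /andP[X0 X1]]; [exact: comb_ge0..|].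
  have /and4P[f1a _ f1b _] := shuffle_product_fin (ltW X0) X1 s1 t0.
  have /and4P[f2a _ f2b _] := shuffle_product_fin (ltW X0) X1 t1 s0.
  have /and4P[f3a _ f3b _] :=
    shuffle_product_fin (ltW X0) X1 (ltnW s1 : 1 < s.+1)%N t0.
  have /and4P[f4a _ f4b _] := shuffle_product_fin (ltW X0) X1 t1 (ltn0Sn s).
  rewrite !comb_gen// /a /b !ohno_lin_generating// shuffle_sum_cyclic ?(ltW X0)//.
  split => //; rewrite !enn_finD f2a f1b /=.
  by rewrite enn_finM ?enn_fin_enn// enn_finD f3a f4b.
split=> [|m].
  by have := eq_comb 0%N; rewrite /comb /a /b /ohno_defect !addr0; lra.
by have := eq_comb m.+1; rewrite /comb /a /b /ohno_defect; lra.
Qed.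

End Conclusion.

Theorem theorem1p6 (R : realType) (s t : nat) (hs : (2 <= s)%N) (ht : (2 <= t)%N) :
  F R s [:: t.+1] = F R t [:: s.+1].
Proof.
apply/funext => m; apply/eqP; rewrite -subr_eq0; apply/eqP.
rewrite -[LHS]/(ohno_defect R s t m).
(* [s] is generalized because the coefficient at m+1 reduces to the one at m for s+1. *)
elim: m s hs => [|m IH] s hs; have [E0 ES] := ohno_defect_rec R hs ht.
  exact: E0.
by rewrite ES IH// ltnW.
Qed.
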